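(* The tensor product on the category of finitely generated projective left $A^-$-modules makes the Grothendieck group $K_0(A^-)$ into a ring, and the assignment $[P_n]\mapsto x^n$, $n\ge0$, defines an isomorphism of rings $K_0(A^-)\cong\mathbb{Z}[x]$. Under this isomorphism the class $[M_n]$ of the standard module $M_n$ (which has a finite resolution by finitely generated projective $A^-$-modules) equals $(x-1)^n$ for every $n\ge 0$.
   Context: Let $\mathbf{k}$ be a field. For $m,n\ge 0$ let ${}_mB^-_n$ be the set of isotopy classes of planar diagrams in the strip $0\le x\le 1$ with $m$ points on the line $x=0$ and $n$ points on the line $x=1$ (numbered from bottom to top), in which $w$ of the left points are joined to $w$ of the right points by $w$ pairwise disjoint arcs (''larcs''), and each remaining left (resp. right) point is the endpoint of a short arc, a ''left sarc'' (resp. ''right sarc''), whose other end lies in the interior of the strip; the projection to the $x$-axis has no critical points. Equivalently, a diagram is a pair of subsets $I\subseteq\{1,\dots,m\}$, $J\subseteq\{1,\dots,n\}$ with $|I|=|J|=w$, the larcs being given by the order-preserving bijection $I\to J$. The (non-unital, associative) $\mathbf{k}$-algebra $A^-$ has basis $B^-=\bigsqcup_{m,n}{}_mB^-_n$. The product $yz$ of $y\in{}_mB^-_n$ and $z\in{}_kB^-_l$ is $0$ if $n\neq k$; if $n=k$ it is the horizontal concatenation ($y$ on the left, $z$ on the right), except that $yz=0$ if the concatenation contains a floating arc (i.e. some middle point is both the endpoint of a right sarc of $y$ and of a left sarc of $z$). A larc concatenated with a sarc becomes a sarc. $1_n\in{}_nB^-_n$ is the diagram with $n$ larcs; the $1_n$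 are mutually orthogonal idempotents. All modules are left $A^-$-modules $M$ with $M=\bigoplus_{n\ge0}1_nM$. $P_n=A^-1_n$. $M_n$ (standard module) is the quotient of $P_n$ by the submodule spanned by diagrams having at least one right sarc. Every finitely generated projective module is isomorphic to a finite direct sum of modules $P_n$. $K_0(A^-)$ is the abelian group generated by symbols $[P]$ of finitely generated projective modules with relations $[P]=[P']+[P'']$ whenever $P\cong P'\oplus P''$. The class of a module $M$ with a finite resolution $0\to Q_r\to\dots\to Q_0\to M\to0$ by finitely generated projectives is $[M]=\sum_i(-1)^i[Q_i]$. Tensor product: a diagram $\alpha\in{}_nB^-_{n'}$ is regarded as the homomorphism $P_n\to P_{n'}$, $a\mapsto a\alpha$, and these form a basis of $\mathrm{Hom}_{A^-}(P_n,P_{n'})$. The bifunctor $\otimes$ is defined by $P_n\otimes P_m=P_{n+m}$ and, for $\alpha\in{}_nB^-_{n'}$, $\beta\in{}_mB^-_{m'}$, by letting $\alpha\otimes\beta\in{}_{n+m}B^-_{n'+m'}$ be the diagram obtained by placing $\alpha$ on top of $\beta$, extended bilinearly and additively. The product in $K_0(A^-)$ is $[P]\cdot[Q]=[P\otimes Q]$. *)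

(* Defs.v *)
From HB Require Import structures.
From mathcomp Require Import all_boot all_order all_algebra.
From mathcomp Require Import finmap boolp.
From mathcomp.multinomials Require Import monalg.
Set Implicit Arguments.
Unset Strict Implicit.
Unset Printing Implicit Defensive.
Import GRing.Theory.
Local Open Scope fset_scope.
Local Open Scope quotient_scope.
Local Open Scope ring_scope.

(* A diagram ((m, n), L) with m left and n right points, both numbered from 0,
   bottom to top, is determined by the set L of pairs (left end, right end) of
   its larcs; every other boundary point carries a sarc. The second condition
   says that the larcs are pairwise disjoint: taken in both directions, it makes
   L the graph of an order-preserving bijection between a set of left points
   and a set of right points. *)
Definition is_diagram (d : (nat * nat) * {fset nat * nat}) : bool :=
  all (fun p => (p.1 < d.1.1)%N && (p.2 < d.1.2)%N) d.2
  && allrel (fun p q => (p.1 < q.1)%N == (p.2 < q.2)%N) d.2 d.2.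

Record diagram := Diagram {
  diagram_val : (nat * nat) * {fset nat * nat};
  diagramP : is_diagram diagram_val }.

HB.instance Definition _ := [isSub for diagram_val].
HB.instance Definition _ := [Choice of diagram by <:].

Definition dleft (d : diagram) : nat := (diagram_val d).1.1.
Definition dright (d : diagram) : nat := (diagram_val d).1.2.
Definition larcs (d : diagram) : {fset nat * nat} := (diagram_val d).2.

Definition left_sarc (d : diagram) (i : nat) : bool :=
  (i < dleft d)%N && ~~ has (fun p => p.1 == i) (larcs d).
Definition right_sarc (d : diagram) (j : nat) : bool :=
  (j < dright d)%N && ~~ has (fun p => p.2 == j) (larcs d).

Lemma diagram_eq (d e : diagram) :
  dleft d = dleft e -> dright d = dright e -> larcs d = larcs e -> d = e.
Proof.
by case: d => [[[a b] c] p]; case: e => [[[a' b'] c'] p'] /=;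
   rewrite /dleft /dright /larcs /= => E1 E2 E3; apply: val_inj; rewrite /= E1 E2 E3.
Qed.

Lemma is_diagramP (m n : nat) (L : {fset nat * nat}) :
  reflect ((forall p, p \in L -> (p.1 < m)%N && (p.2 < n)%N) /\
           (forall p q, p \in L -> q \in L -> (p.1 < q.1)%N = (p.2 < q.2)%N))
    (is_diagram ((m, n), L)).
Proof.
apply: (iffP andP) => [[/allP H1 /allrelP H2]|[H1 H2]]; split.
- exact: H1.
- by move=> p q pL qL; have /eqP := H2 p q pL qL.
- by apply/allP.
- by apply/allrelP => p q pL qL /=; rewrite (H2 p q).
Qed.

Definition larcs_cat (y z : diagram) : {fset nat * nat} :=
  [fset (p.1, q.2) | p in larcs y, q in [fset q in larcs z | p.2 == q.1]].

Lemma larcs_catP (y z : diagram) (i l : nat) :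
  reflect (exists j, (i, j) \in larcs y /\ (j, l) \in larcs z)
    ((i, l) \in larcs_cat y z).
Proof.
apply: (iffP (imfset2P _ _ _ _ _)) => /=.
- move=> [[i' j] pL [[j' l'] /=]]; rewrite inE /= => /andP[qL /eqP E] [-> ->].
  by exists j; split => //; rewrite E.
- move=> [j [H1 H2]]; exists (i, j) => //; exists (j, l) => //.
  by rewrite !inE /= H2 /=.
Qed.

Lemma larcs_bound (d : diagram) i j :
  (i, j) \in larcs d -> (i < dleft d)%N && (j < dright d)%N.
Proof.
case: d => [[[a b] c] p]; rewrite /larcs /dleft /dright /= => H.
by have /is_diagramP[/(_ _ H)] := p.
Qed.

Lemma larcs_mono (d : diagram) i j i' j' :
  (i, j) \in larcs d -> (i', j') \in larcs d -> (i < i')%N = (j < j')%N.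
Proof.
case: d => [[[a b] c] p]; rewrite /larcs /= => H H'.
by have /is_diagramP[_ /(_ _ _ H H')] := p.
Qed.

Lemma dcat_subproof (y z : diagram) :
  is_diagram ((dleft y, dright z), larcs_cat y z).
Proof.
apply/is_diagramP; split.
- move=> [i l] /larcs_catP[j [/larcs_bound/andP[? _] /larcs_bound/andP[_ ?]]].
  by apply/andP.
- move=> [i l] [i' l'] /larcs_catP[j [H1 H2]] /larcs_catP[j' [H1' H2']] /=.
  by rewrite (larcs_mono H1 H1') (larcs_mono H2 H2').
Qed.

(* The concatenation with floating arcs, if any, erased; the product in the
   algebra only uses it under [composable]. *)
Definition dcat (y z : diagram) : diagram := Diagram (dcat_subproof y z).

Definition composable (y z : diagram) : bool :=
  (dright y == dleft z)
  && ~~ has (fun j => right_sarc y j && left_sarc z j) (iota 0 (dright y)).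

Definition larcs_id (n : nat) : {fset nat * nat} := [fset (i, i) | i in iota 0 n].

Lemma larcs_idP n i j : ((i, j) \in larcs_id n) = (i == j) && (i < n)%N.
Proof.
apply/imfsetP/andP => /= [[k]|[/eqP<- lt]].
- by rewrite mem_iota /= => lt [-> ->].
- by exists i => //; rewrite mem_iota.
Qed.

Lemma did_subproof n : is_diagram ((n, n), larcs_id n).
Proof.
apply/is_diagramP; split.
- by move=> [i j]; rewrite larcs_idP /= => /andP[/eqP<- ->].
- by move=> [i j] [i' j']; rewrite !larcs_idP /= => /andP[/eqP<- _] /andP[/eqP<- _].
Qed.

Definition did (n : nat) : diagram := Diagram (did_subproof n).

(* The first argument is placed on top, so it is its points that are shifted. *)
Definition larcs_tens (a b : diagram) : {fset nat * nat} :=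
  larcs b `|` [fset ((dleft b + p.1)%N, (dright b + p.2)%N) | p in larcs a].

Lemma larcs_tensP (a b : diagram) i j :
  reflect ((i, j) \in larcs b \/
     exists i' j', [/\ (i', j') \in larcs a, i = (dleft b + i')%N & j = (dright b + j')%N])
    ((i, j) \in larcs_tens a b).
Proof.
rewrite inE; apply: (iffP orP) => -[H|H]; [by left|right|by left|right].
- by have /imfsetP[[i' j'] /= H' [-> ->]] := H; exists i', j'.
- by have [i' [j' [H1 -> ->]]] := H; apply/imfsetP; exists (i', j').
Qed.

Lemma dtens_subproof (a b : diagram) :
  is_diagram (((dleft a + dleft b)%N, (dright a + dright b)%N), larcs_tens a b).
Proof.
apply/is_diagramP; split.
- move=> [i j] /larcs_tensP[/larcs_bound/andP[H1 H2]|[i' [j' []]]] /=.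
    by rewrite !ltn_addl.
  move=> /larcs_bound/andP[H1 H2] -> ->.
  by rewrite (addnC (dleft a)) (addnC (dright a)) !ltn_add2l H1 H2.
- move=> [i j] [i2 j2] /larcs_tensP[H1|[i' [j' [H1 -> ->]]]]
    /larcs_tensP[H2|[i2' [j2' [H2 -> ->]]]] /=.
  + exact: larcs_mono H1 H2.
  + by have /andP[K1 K2] := larcs_bound H1; rewrite !ltn_addr.
  + by have /andP[K1 K2] := larcs_bound H2; rewrite !ltnNge !(leq_trans (ltnW _) (leq_addr _ _)).
  + by rewrite !ltn_add2l (larcs_mono H1 H2).
Qed.

Definition dtens (a b : diagram) : diagram := Diagram (dtens_subproof a b).

Lemma larcs_inj_r (d : diagram) i i' j :
  (i, j) \in larcs d -> (i', j) \in larcs d -> i = i'.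
Proof.
move=> H H'; have E := larcs_mono H H'; have E' := larcs_mono H' H.
by move: E E'; rewrite !ltnn; case: ltngtP.
Qed.

Lemma larcs_inj_l (d : diagram) i j j' :
  (i, j) \in larcs d -> (i, j') \in larcs d -> j = j'.
Proof.
move=> H H'; have E := larcs_mono H H'; have E' := larcs_mono H' H.
by move: E E'; rewrite !ltnn; case: ltngtP.
Qed.

Lemma left_sarcPn (d : diagram) i : (i < dleft d)%N ->
  reflect (exists j, (i, j) \in larcs d) (~~ left_sarc d i).
Proof.
move=> lt; rewrite /left_sarc lt /= negbK.
apply: (iffP hasP) => [[[a b] /= H /eqP<-]|[j H]]; first by exists b.
by exists (i, j) => /=.
Qed.

Lemma right_sarcPn (d : diagram) j : (j < dright d)%N ->
  reflect (exists i, (i, j) \in larcs d) (~~ right_sarc d j).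
Proof.
move=> lt; rewrite /right_sarc lt /= negbK.
apply: (iffP hasP) => [[[a b] /= H /eqP<-]|[i H]]; first by exists a.
by exists (i, j) => /=.
Qed.

Lemma composableP (y z : diagram) :
  reflect (dright y = dleft z /\ forall j, (j < dright y)%N ->
     (exists i, (i, j) \in larcs y) \/ (exists l, (j, l) \in larcs z))
    (composable y z).
Proof.
apply: (iffP andP) => [[/eqP E /hasPn H]|[E H]].
  split=> // j lt; move: (H j); rewrite mem_iota /= => /(_ lt).
  rewrite negb_and => /orP[/(right_sarcPn lt)|]; first by left.
  by rewrite E in lt => /(left_sarcPn lt); right.
rewrite E eqxx; split=> //; apply/hasPn => j; rewrite mem_iota /= => lt.
rewrite -E in lt; rewrite negb_and; case: (H j lt) => H'.
  by move/(right_sarcPn lt): H' => ->.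
by rewrite E in lt; move/(left_sarcPn lt): H' => ->; rewrite orbT.
Qed.

Lemma dcatA x y z : dcat x (dcat y z) = dcat (dcat x y) z.
Proof.
apply: diagram_eq => //; apply/fsetP => -[i l].
apply/larcs_catP/larcs_catP => -[j [H1 H2]].
  move/larcs_catP: H2 => [j' [H2 H3]]; exists j'; split=> //.
  by apply/larcs_catP; exists j.
move/larcs_catP: H1 => [j' [H1 H3]]; exists j'; split=> //.
by apply/larcs_catP; exists j.
Qed.

Lemma composableA x y z :
  composable x y && composable (dcat x y) z = composable y z && composable x (dcat y z).
Proof.
apply/andP/andP => -[/composableP[E1 H1] /composableP[E2 H2]];
  split; apply/composableP; split=> // j lt.
- case: (H2 j lt) => [[i /larcs_catP[j' [_ H]]]|]; last by right.
  by left; exists j'.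
- case: (H1 j lt) => [|[i H]]; first by left.
  have /andP[_ lt'] := larcs_bound H.
  case: (H2 i lt') => [[i' /larcs_catP[j' [Ha Hb]]]|[l Hl]].
    by left; exists i'; rewrite (larcs_inj_r H Hb).
  by right; exists l; apply/larcs_catP; exists i.
- case: (H2 j lt) => [|[l /larcs_catP[j' [H _]]]]; first by left.
  by right; exists j'.
- case: (H1 j lt) => [[i H]|]; last by right.
  have /andP[lt' _] := larcs_bound H.
  rewrite -(E2 : dright x = dleft y) in lt'; case: (H2 i lt') => [[i' Hi]|[l /larcs_catP[j' [Ha Hb]]]].
    by left; exists i'; apply/larcs_catP; exists i.
  by right; exists l; rewrite (larcs_inj_l H Ha).
Qed.

Lemma did_catr y : dcat y (did (dright y)) = y.
Proof.
apply: diagram_eq => //; apply/fsetP => -[i j]; apply/larcs_catP/idP.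
  by move=> [j' [H]]; rewrite larcs_idP => /andP[/eqP<- _].
move=> H; exists j; split=> //; rewrite larcs_idP eqxx /=.
by case/andP: (larcs_bound H).
Qed.

Lemma did_catl y : dcat (did (dleft y)) y = y.
Proof.
apply: diagram_eq => //; apply/fsetP => -[i j]; apply/larcs_catP/idP.
  by move=> [j' []]; rewrite larcs_idP => /andP[/eqP<- _].
move=> H; exists i; split=> //; rewrite larcs_idP eqxx /=.
by case/andP: (larcs_bound H).
Qed.

Lemma composable_didr y n : composable y (did n) = (dright y == n).
Proof.
apply/composableP/eqP => [[]//|E]; split=> // j lt; right; exists j.
by rewrite larcs_idP eqxx /= -E.
Qed.

Lemma composable_didl y n : composable (did n) y = (dleft y == n).
Proof.
apply/composableP/eqP => [[]//|E]; split=> // j lt; left; exists j.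
by rewrite larcs_idP eqxx.
Qed.

Definition Aminus (k : fieldType) : Type := {malg k[diagram]}.
HB.instance Definition _ (k : fieldType) := GRing.Lmodule.on (Aminus k).

Definition basis (k : fieldType) (d : diagram) : Aminus k := << 1 *g d >>.

Definition dmul (k : fieldType) (y z : diagram) : Aminus k :=
  if composable y z then basis k (dcat y z) else 0.

Definition mulA (k : fieldType) (a b : Aminus k) : Aminus k :=
  \sum_(y <- msupp a) \sum_(z <- msupp b) (a@_y * b@_z) *: dmul k y z.

Definition idA (k : fieldType) (n : nat) : Aminus k := basis k (did n).

Section LinearExtension.
Context (k : fieldType) (V : lmodType k).
Implicit Types (f g : diagram -> V) (a b : Aminus k).

Definition lext f a : V := \sum_(x <- msupp a) a@_x *: f x.

Lemma lext_sub f a (D : {fset diagram}) : msupp a `<=` D ->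
  lext f a = \sum_(x <- D) a@_x *: f x.
Proof.
move=> sD; rewrite /lext; apply: big_fset_incl => // x _ /mcoeff_outdom ->.
by rewrite scale0r.
Qed.

Lemma lextP f c a b : lext f (c *: a + b) = c *: lext f a + lext f b.
Proof.
set D := msupp (c *: a + b) `|` (msupp a `|` msupp b).
rewrite (@lext_sub f a D) ?(@lext_sub f b D) ?(@lext_sub f (_ + _) D).
- rewrite scaler_sumr -big_split; apply: eq_bigr => x _ /=.
  by rewrite mcoeffD mcoeffZ scalerDl scalerA.
- exact: fsubsetUl.
- by rewrite /D fsetUA fsubsetUr.
- by rewrite /D fsetUCA fsubsetUl.
Qed.

HB.instance Definition _ f := GRing.isLinear.Build k (Aminus k) V _ (lext f)
  (fun c a b => lextP f c a b).

Lemma lext_basis f d : lext f (basis k d) = f d.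
Proof.
rewrite (@lext_sub f _ [fset d]) ?msuppU_le // big_seq_fset1.
by rewrite /basis mcoeffUU scale1r.
Qed.

Lemma lext_ext f g a : f =1 g -> lext f a = lext g a.
Proof. by move=> E; apply: eq_bigr => x _; rewrite E. Qed.

Lemma Aminus_basisE a : a = \sum_(x <- msupp a) a@_x *: basis k x.
Proof.
apply/malgP => d; rewrite {1}[a]monalgE; congr mcoeff; apply: eq_bigr => x _.
apply/malgP => e; rewrite mcoeffZ /basis !mcoeffU.
by case: (x == e); rewrite ?mulr1n ?mulr1 ?mulr0n ?mulr0.
Qed.

Lemma Aminus_ind (P : Aminus k -> Prop) :
  P 0 -> (forall d, P (basis k d)) ->
  (forall c a b, P a -> P b -> P (c *: a + b)) -> forall a, P a.
Proof.
move=> P0 Pb Pl a; rewrite [a]Aminus_basisE; elim: (enum_fset _) => [|x s IH].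
  by rewrite big_nil.
by rewrite big_cons; apply: Pl.
Qed.

End LinearExtension.

Section AlgebraTheory.
Context (k : fieldType).
Implicit Types a b c : Aminus k.

Lemma mulA_lext a b : mulA a b = lext (fun y => lext (dmul k y) b) a.
Proof.
apply: eq_bigr => y _; rewrite /lext scaler_sumr; apply: eq_bigr => z _.
by rewrite scalerA.
Qed.

Lemma mulA_linl x a b c : mulA (x *: a + b) c = x *: mulA a c + mulA b c.
Proof. by rewrite !mulA_lext linearP. Qed.

Lemma mulA_linr x a b c : mulA a (x *: b + c) = x *: mulA a b + mulA a c.
Proof.
rewrite !mulA_lext /lext !scaler_sumr -big_split /=; apply: eq_bigr => y _.
by rewrite -/(lext _ _) lextP scalerDr !scalerA mulrC.
Qed.

Lemma mulA_basis y z : mulA (basis k y) (basis k z) = dmul k y z.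
Proof. by rewrite mulA_lext !lext_basis. Qed.

Lemma mul0A a : mulA 0 a = 0.
Proof. by rewrite mulA_lext linear0. Qed.

Lemma mulA0 a : mulA a 0 = 0.
Proof. by have := mulA_linr (-1) a 0 0; rewrite scaler0 addr0 scaleN1r addNr. Qed.

Lemma mulAA : associative (@mulA k).
Proof.
move=> a b c; elim/Aminus_ind: a => [|x|u a a' IH IH']; first by rewrite !mul0A.
  2: by rewrite !mulA_linl IH IH'.
elim/Aminus_ind: b => [|y|u b b' IH IH']; first by rewrite !(mul0A, mulA0).
  2: by rewrite !(mulA_linl, mulA_linr) IH IH'.
elim/Aminus_ind: c => [|z|u c c' IH IH']; first by rewrite !mulA0.
  2: by rewrite !mulA_linr IH IH'.
rewrite !mulA_basis /dmul; have := composableA x y z.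
case: (composable y z); case: (composable x y) => /= H;
  rewrite ?mul0A ?mulA0 ?mulA_basis /dmul //.
- by rewrite H dcatA.
- by rewrite -H.
- by rewrite H.
Qed.

Lemma mulA_id m n : mulA (idA k m) (idA k n) = if m == n then idA k n else 0.
Proof.
rewrite mulA_basis /dmul composable_didl -[dleft (did n)]/n eq_sym.
by case: eqVneq => // ->; rewrite (did_catl (did n)).
Qed.

Lemma basis_id d n :
  mulA (basis k d) (idA k n) = if dright d == n then basis k d else 0.
Proof.
rewrite mulA_basis /dmul composable_didr; case: eqP => // <-.
by rewrite did_catr.
Qed.

Lemma id_basis d n :
  mulA (idA k n) (basis k d) = if dleft d == n then basis k d else 0.
Proof.
rewrite mulA_basis /dmul composable_didl; case: eqP => // <-.
by rewrite did_catl.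
Qed.

Lemma idA_bound a : exists N, a = \sum_(n < N) mulA (idA k n) a.
Proof.
suff [N0 H0] : exists N0, forall N, (N0 <= N)%N -> a = \sum_(n < N) mulA (idA k n) a.
  by exists N0; apply: H0.
elim/Aminus_ind: a => [|d|c a b [N1 H1] [N2 H2]].
- by exists 0 => N _; rewrite big1 // => i _; rewrite mulA0.
- exists (dleft d).+1 => N lt; rewrite (bigD1 (Ordinal lt)) //= id_basis eqxx.
  rewrite big1 ?addr0 // => i ne; rewrite id_basis; case: eqP => // E.
  by case/eqP: ne; apply: val_inj.
- exists (maxn N1 N2) => N; rewrite geq_max => /andP[le1 le2].
  rewrite {1}(H1 N le1) {1}(H2 N le2) scaler_sumr -big_split.
  by apply: eq_bigr => i _; rewrite mulA_linr.
Qed.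

End AlgebraTheory.

(* [act_unital] is M = (+)_n 1_n M: the sum is automatically direct, since the
   1_n are orthogonal idempotents, and the components of x are the 1_n x. *)
HB.mixin Record isAModule (k : fieldType) M of GRing.Lmodule k M := {
  act : Aminus k -> M -> M;
  act_linl : forall (c : k) (a b : Aminus k) (x : M),
    act (c *: a + b) x = c *: act a x + act b x;
  act_linr : forall (a : Aminus k) (c : k) (x y : M),
    act a (c *: x + y) = c *: act a x + act a y;
  actM : forall (a b : Aminus k) (x : M), act (mulA a b) x = act a (act b x);
  act_unital : forall x : M, exists N, x = \sum_(n < N) act (idA k n) x
}.

#[short(type="amodType")]
HB.structure Definition AModule (k : fieldType) :=
  {M of GRing.Lmodule k M & isAModule k M}.

Section ActTheory.
Context (k : fieldType) (M : amodType k).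
Lemma act0l (x : M) : act 0 x = 0.
Proof. by have := act_linl (-1) 0 0 x; rewrite scaler0 addr0 scaleN1r addNr. Qed.
Lemma act0r (a : Aminus k) : act a (0 : M) = 0.
Proof. by have := act_linr a (-1) (0 : M) 0; rewrite scaler0 addr0 scaleN1r addNr. Qed.
Lemma actDr (a : Aminus k) (x y : M) : act a (x + y) = act a x + act a y.
Proof. by have := act_linr a 1 x y; rewrite !scale1r. Qed.
Lemma actZr (a : Aminus k) c (x : M) : act a (c *: x) = c *: act a x.
Proof. by have := act_linr a c x 0; rewrite act0r !addr0. Qed.
Lemma act_sumr (a : Aminus k) N (F : 'I_N -> M) :
  act a (\sum_(i < N) F i) = \sum_(i < N) act a (F i).
Proof. by apply: (big_morph (act a)); [exact: actDr | exact: act0r]. Qed.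
End ActTheory.

Record ahom (k : fieldType) (M N : amodType k) := AHom {
  ahom_lin :> {linear M -> N};
  ahom_act : forall (a : Aminus k) (x : M), ahom_lin (act a x) = act a (ahom_lin x) }.

Definition ahom_id (k : fieldType) (M : amodType k) : ahom M M :=
  @AHom k M M idfun (fun _ _ => erefl).

Lemma ahom_comp_subproof (k : fieldType) (M N L : amodType k)
  (g : ahom N L) (f : ahom M N) a x : (g \o f) (act a x) = act a ((g \o f) x).
Proof. by rewrite /= !ahom_act. Qed.

Definition ahom_comp (k : fieldType) (M N L : amodType k)
    (g : ahom N L) (f : ahom M N) : ahom M L :=
  @AHom k M L (g \o f) (ahom_comp_subproof g f).

Lemma ahom_lincomb_subproof (k : fieldType) (M N : amodType k)
  (c : k) (f g : ahom M N) a x :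
  ((c \*: f) \+ g) (act a x) = act a (((c \*: f) \+ g) x).
Proof. by rewrite /= !ahom_act act_linr. Qed.

Definition ahom_lincomb (k : fieldType) (M N : amodType k)
    (c : k) (f g : ahom M N) : ahom M N :=
  @AHom k M N ((c \*: f) \+ g) (ahom_lincomb_subproof c f g).

Definition aiso (k : fieldType) (M N : amodType k) : Prop :=
  exists f : ahom M N, bijective f.

Definition aprojective (k : fieldType) (P : amodType k) : Prop :=
  forall (M N : amodType k) (p : ahom M N) (g : ahom P N),
    (forall y, exists x, p x = y) -> exists h : ahom P M, forall x, p (h x) = g x.

Definition afingen (k : fieldType) (M : amodType k) : Prop :=
  exists s : seq M, forall x : M, exists a : 'I_(size s) -> Aminus k,
    x = \sum_(i < size s) act (a i) s`_i.

Section DirectSum.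
Context (k : fieldType) (M N : amodType k).

Definition prod_act (a : Aminus k) (x : M * N) : M * N := (act a x.1, act a x.2).

Lemma prod_act_linl (c : k) (a b : Aminus k) x :
  prod_act (c *: a + b) x = c *: prod_act a x + prod_act b x.
Proof. by congr pair; rewrite /= act_linl. Qed.
Lemma prod_act_linr (a : Aminus k) (c : k) x y :
  prod_act a (c *: x + y) = c *: prod_act a x + prod_act a y.
Proof. by congr pair; rewrite /= act_linr. Qed.
Lemma prod_actM (a b : Aminus k) x : prod_act (mulA a b) x = prod_act a (prod_act b x).
Proof. by congr pair; rewrite /= actM. Qed.
End DirectSum.

Lemma act_unital_ge (k : fieldType) (M : amodType k) (x : M) :
  exists N0, forall N, (N0 <= N)%N -> x = \sum_(n < N) act (idA k n) x.
Proof.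
have [N0 E] := act_unital x; exists N0 => N leN.
have Z n : (N0 <= n)%N -> act (idA k n) x = 0.
  move=> len; rewrite E act_sumr big1 // => i _; rewrite -actM mulA_id.
  by rewrite eqn_leq leqNgt (leq_trans (ltn_ord i) len) /= act0l.
rewrite {1}E -(subnKC leN) big_split_ord /= [X in _ + X]big1 ?addr0 // => i _.
by rewrite Z // leq_addr.
Qed.

Lemma prod_act_unital (k : fieldType) (M N : amodType k) (x : M * N) :
  exists n0, x = \sum_(n < n0) prod_act (idA k n) x.
Proof.
case: x => x y; have [n1 H1] := act_unital_ge x; have [n2 H2] := act_unital_ge y.
exists (maxn n1 n2).
have F (z : M * N) : z = (z.1, z.2) by case: z.
rewrite [RHS]F (raddf_sum fst) (raddf_sum snd) /=; congr pair.
  by apply: H1; rewrite leq_maxl.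
by apply: H2; rewrite leq_maxr.
Qed.

HB.instance Definition _ (k : fieldType) (M N : amodType k) :=
  isAModule.Build k (M * N)%type (@prod_act_linl k M N) (@prod_act_linr k M N)
    (@prod_actM k M N) (@prod_act_unital k M N).

Record asubmod (k : fieldType) (M : amodType k) := ASubmod {
  asub_pred :> {pred M};
  asub_submod : submod_closed asub_pred;
  asub_act : forall (a : Aminus k) (x : M), x \in asub_pred -> act a x \in asub_pred }.

HB.instance Definition _ (k : fieldType) (M : amodType k) (S : asubmod M) :=
  GRing.isSubmodClosed.Build k M (asub_pred S) (asub_submod S).

Definition aquot (k : fieldType) (M : amodType k) (S : asubmod M) : Type :=
  Quotient.quot (asub_pred S).
HB.instance Definition _ (k : fieldType) (M : amodType k) (S : asubmod M) :=
  GRing.Zmodule.on (aquot S).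

Section Quotient.
Context (k : fieldType) (M : amodType k) (S : asubmod M).
Local Notation Q := (aquot S).

Definition aquot_pi (x : M) : Q := \pi_(Quotient.quot (asub_pred S)) x.

Lemma aquot_piP (x y : M) : aquot_pi x = aquot_pi y <-> x - y \in S.
Proof.
have H : (x - y \in S) = (aquot_pi x == aquot_pi y) := Quotient.idealrBE _ x y.
by rewrite H; split=> [->|/eqP].
Qed.

Definition aquot_scale (c : k) (q : Q) : Q := aquot_pi (c *: repr q).
Definition aquot_act (a : Aminus k) (q : Q) : Q := aquot_pi (act a (repr q)).

Lemma aquot_reprK (q : Q) : aquot_pi (repr q) = q.
Proof. exact: reprK. Qed.

Lemma aquot_piD (x y : M) : aquot_pi (x + y) = aquot_pi x + aquot_pi y.
Proof. by rewrite /aquot_pi piE. Qed.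

Lemma aquot_piZ (c : k) (x : M) : aquot_scale c (aquot_pi x) = aquot_pi (c *: x).
Proof.
apply/aquot_piP; rewrite -scalerBr; apply: rpredZ.
by apply/aquot_piP; rewrite aquot_reprK.
Qed.

Lemma aquot_pi_act (a : Aminus k) (x : M) : aquot_act a (aquot_pi x) = aquot_pi (act a x).
Proof.
apply/aquot_piP.
rewrite -scaleN1r -actZr -actDr scaleN1r; apply: asub_act.
by apply/aquot_piP; rewrite aquot_reprK.
Qed.

Lemma aquot_ind (P : Q -> Prop) : (forall x, P (aquot_pi x)) -> forall q, P q.
Proof. by move=> H q; rewrite -[q]aquot_reprK. Qed.

Lemma aquot_scaleA (c d : k) (q : Q) :
  aquot_scale c (aquot_scale d q) = aquot_scale (c * d) q.
Proof. by elim/aquot_ind: q => x; rewrite !aquot_piZ scalerA. Qed.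
Lemma aquot_scale1 : left_id 1 aquot_scale.
Proof. by move=> q; elim/aquot_ind: q => x; rewrite aquot_piZ scale1r. Qed.
Lemma aquot_scaleDr : right_distributive aquot_scale +%R.
Proof.
move=> c q r; elim/aquot_ind: q => x; elim/aquot_ind: r => y.
by rewrite -aquot_piD !aquot_piZ scalerDr aquot_piD.
Qed.
Lemma aquot_scaleDl (q : Q) : {morph aquot_scale^~ q : c d / c + d}.
Proof.
move=> c d; elim/aquot_ind: q => x.
by rewrite !aquot_piZ scalerDl aquot_piD.
Qed.

HB.instance Definition _ := GRing.Zmodule_isLmodule.Build k Q
  aquot_scaleA aquot_scale1 aquot_scaleDr aquot_scaleDl.

Lemma aquot_pi_linear (c : k) (x y : M) :
  aquot_pi (c *: x + y) = c *: aquot_pi x + aquot_pi y.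
Proof. by rewrite aquot_piD -aquot_piZ. Qed.

Lemma aquot_act_linl (c : k) (a b : Aminus k) (q : Q) :
  aquot_act (c *: a + b) q = c *: aquot_act a q + aquot_act b q.
Proof. by elim/aquot_ind: q => x; rewrite !aquot_pi_act act_linl aquot_pi_linear. Qed.
Lemma aquot_act_linr (a : Aminus k) (c : k) (q r : Q) :
  aquot_act a (c *: q + r) = c *: aquot_act a q + aquot_act a r.
Proof.
elim/aquot_ind: q => x; elim/aquot_ind: r => y.
by rewrite -aquot_pi_linear !aquot_pi_act act_linr aquot_pi_linear.
Qed.
Lemma aquot_actM (a b : Aminus k) (q : Q) :
  aquot_act (mulA a b) q = aquot_act a (aquot_act b q).
Proof. by elim/aquot_ind: q => x; rewrite !aquot_pi_act actM. Qed.
Lemma aquot_act_unital (q : Q) :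
  exists N, q = \sum_(n < N) aquot_act (idA k n) q.
Proof.
elim/aquot_ind: q => x; have [N E] := act_unital x; exists N.
rewrite {1}E (big_morph aquot_pi aquot_piD (_ : _ = 0)).
  by apply: eq_bigr => i _; rewrite aquot_pi_act.
by have := aquot_pi_linear (-1) 0 0; rewrite scaler0 addr0 scaleN1r addNr.
Qed.

HB.instance Definition _ := isAModule.Build k Q
  aquot_act_linl aquot_act_linr aquot_actM aquot_act_unital.

End Quotient.

Section Pn.
Context (k : fieldType) (n : nat).

(* A 1_n as the set of fixed points of the right multiplication by 1_n. *)
Definition Pn_pred : {pred Aminus k} := fun a => mulA a (idA k n) == a.

Lemma Pn_pred_submod : submod_closed Pn_pred.
Proof.
split=> [|c a b]; rewrite !unfold_in ?mul0A // => /eqP Ha /eqP Hb.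
by rewrite mulA_linl Ha Hb.
Qed.
HB.instance Definition _ := GRing.isSubmodClosed.Build k (Aminus k) Pn_pred Pn_pred_submod.

Record Pn := MkPn { Pn_val : Aminus k; Pn_valP : Pn_val \in Pn_pred }.
HB.instance Definition _ := [isSub for Pn_val].
HB.instance Definition _ := [Choice of Pn by <:].
HB.instance Definition _ := [SubChoice_isSubLmodule of Pn by <:].

Lemma Pn_act_subproof (a : Aminus k) (x : Pn) : mulA a (Pn_val x) \in Pn_pred.
Proof. by rewrite unfold_in -mulAA (eqP (Pn_valP x)). Qed.

Definition Pn_act (a : Aminus k) (x : Pn) : Pn := MkPn (Pn_act_subproof a x).

Lemma Pn_valL c (x y : Pn) : Pn_val (c *: x + y) = c *: Pn_val x + Pn_val y.
Proof. exact: (linearP (val : Pn -> Aminus k)). Qed.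

Lemma Pn_act_linl (c : k) (a b : Aminus k) (x : Pn) :
  Pn_act (c *: a + b) x = c *: Pn_act a x + Pn_act b x.
Proof. by apply: val_inj; rewrite [RHS]Pn_valL [LHS]mulA_linl. Qed.
Lemma Pn_act_linr (a : Aminus k) (c : k) (x y : Pn) :
  Pn_act a (c *: x + y) = c *: Pn_act a x + Pn_act a y.
Proof.
apply: val_inj; rewrite [RHS]Pn_valL -[LHS]/(mulA a (Pn_val (c *: x + y))).
by rewrite Pn_valL mulA_linr.
Qed.
Lemma Pn_actM (a b : Aminus k) (x : Pn) : Pn_act (mulA a b) x = Pn_act a (Pn_act b x).
Proof. by apply: val_inj; rewrite /= mulAA. Qed.
Lemma Pn_act_unital (x : Pn) : exists N, x = \sum_(m < N) Pn_act (idA k m) x.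
Proof.
have [N E] := idA_bound (Pn_val x); exists N; apply: val_inj.
by rewrite raddf_sum; exact: E.
Qed.

HB.instance Definition _ := isAModule.Build k Pn
  Pn_act_linl Pn_act_linr Pn_actM Pn_act_unital.

End Pn.

Section Standard.
Context (k : fieldType) (n : nat).

(* The span of the diagrams with at least one right sarc: all the diagrams in
   the support of x are such. *)
Definition Sn_pred : {pred Pn k n} := fun x =>
  all (fun d => has (right_sarc d) (iota 0 (dright d))) (msupp (Pn_val x)).

Lemma Sn_predP (x : Pn k n) :
  reflect (forall d, (Pn_val x)@_d != 0 -> exists j, right_sarc d j) (x \in Sn_pred).
Proof.
apply: (iffP allP) => H d.
  by rewrite mcoeff_neq0 => /H/hasP[j _]; exists j.
rewrite -mcoeff_neq0 => /H[j Hj]; apply/hasP; exists j => //.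
by rewrite mem_iota; case/andP: Hj.
Qed.

Lemma Sn_submod : submod_closed Sn_pred.
Proof.
split=> [|c x y /Sn_predP Hx /Sn_predP Hy]; apply/Sn_predP => d.
  by rewrite mcoeff0 eqxx.
rewrite Pn_valL mcoeffD mcoeffZ.
have [->|/Hx //] := eqVneq (Pn_val x)@_d 0.
by rewrite mulr0 add0r => /Hy.
Qed.

Lemma right_sarc_dcat y z j : composable y z -> right_sarc z j -> right_sarc (dcat y z) j.
Proof.
move=> _ Hz; have lt : (j < dright z)%N by case/andP: Hz.
apply/negPn/negP => /(@right_sarcPn (dcat y z) j lt)[i /larcs_catP[l [_ H]]].
by move/negP: (introT (right_sarcPn lt) (ex_intro _ l H)); rewrite Hz.
Qed.

Lemma Sn_act (a : Aminus k) (x : Pn k n) : x \in Sn_pred -> act a x \in Sn_pred.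
Proof.
move=> /Sn_predP Hx; apply/Sn_predP => d; rewrite [Pn_val _]/(mulA a (Pn_val x)).
rewrite /mulA raddf_sum /=; apply: contra_neqP => Hd.
rewrite big1 // => y _; rewrite raddf_sum /= big_seq big1 // => z.
rewrite -mcoeff_neq0 mcoeffZ => /Hx[j Hj]; rewrite /dmul.
case: ifP => C; last by rewrite mcoeff0 mulr0.
rewrite /basis mcoeffU; case: eqP => [E|_]; last by rewrite mulr0.
by case: Hd; exists j; rewrite -E; apply: right_sarc_dcat.
Qed.

Definition Sn : asubmod (Pn k n) := ASubmod Sn_submod Sn_act.

Definition Mn : amodType k := aquot Sn.

End Standard.

Record fgproj (k : fieldType) := FGProj {
  fgproj_mod :> amodType k;
  fgproj_proj : aprojective fgproj_mod;
  fgproj_fin : afingen fgproj_mod }.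

Section PnProjective.
Context (k : fieldType) (n : nat).

Lemma Pn_one_subproof : idA k n \in Pn_pred n.
Proof. by rewrite unfold_in mulA_id eqxx. Qed.
Definition Pn_one : Pn k n := MkPn Pn_one_subproof.

Lemma act_Pn_one (x : Pn k n) : act (Pn_val x) Pn_one = x.
Proof. by apply: val_inj; exact/eqP/(Pn_valP x). Qed.

Lemma Pn_fingen : afingen (Pn k n : amodType k).
Proof.
exists [:: Pn_one] => x; exists (fun=> Pn_val x).
by rewrite big_ord1 /= act_Pn_one.
Qed.

Lemma Pn_hom_linear (M : amodType k) (m : M) :
  linear (fun x : Pn k n => act (Pn_val x) m).
Proof. by move=> c x y; rewrite Pn_valL act_linl. Qed.

Lemma Pn_proj : aprojective (Pn k n : amodType k).
Proof.
move=> M N p g sp; have [m Em] := sp (g Pn_one).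
pose f0 : Pn k n -> M := fun x => act (Pn_val x) m.
pose fL := GRing.isLinear.Build k (Pn k n) M _ f0 (Pn_hom_linear m).
pose fl : {linear Pn k n -> M} := HB.pack f0 fL.
have fa (a : Aminus k) (x : Pn k n) : fl (act a x) = act a (fl x) by exact: actM.
exists (AHom fa) => x.
by rewrite /= /f0 ahom_act Em -ahom_act act_Pn_one.
Qed.

Definition Pfg : fgproj k := FGProj Pn_proj Pn_fingen.

End PnProjective.

Section RightMul.
Context (k : fieldType) (d : diagram).

Lemma rmul_subproof (x : Pn k (dleft d)) :
  mulA (Pn_val x) (basis k d) \in Pn_pred (dright d).
Proof. by rewrite unfold_in -mulAA basis_id eqxx. Qed.

Definition rmul_fun (x : Pn k (dleft d)) : Pn k (dright d) := MkPn (rmul_subproof x).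

Lemma rmul_linear : linear rmul_fun.
Proof.
move=> c x y; apply: val_inj; rewrite [RHS]Pn_valL.
by rewrite -[LHS]/(mulA (Pn_val (c *: x + y)) (basis k d)) Pn_valL mulA_linl.
Qed.
HB.instance Definition _ :=
  GRing.isLinear.Build k (Pn k (dleft d)) (Pn k (dright d)) _ rmul_fun rmul_linear.

Lemma rmul_act (a : Aminus k) (x : Pn k (dleft d)) :
  rmul_fun (act a x) = act a (rmul_fun x).
Proof. by apply: val_inj; rewrite /= mulAA. Qed.

Definition rmul : ahom (Pfg k (dleft d)) (Pfg k (dright d)) := AHom rmul_act.
End RightMul.

(* Bilinear bifunctors on the finitely generated projective modules which are
   P_n (x) P_m = P_{n+m} on the P_n (identified through [tens_Pn]), and are given
   by stacking of diagrams on the morphisms between them. A bilinear functor is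
   additive, and every finitely generated projective module is a finite direct
   sum of P_n, so this determines the bifunctor up to isomorphism. *)
Record tensor_product (k : fieldType) := TensorProduct {
  tens_obj :> fgproj k -> fgproj k -> fgproj k;
  tens_hom : forall P P' Q Q' : fgproj k,
    ahom P P' -> ahom Q Q' -> ahom (tens_obj P Q) (tens_obj P' Q');
  tens_id : forall P Q : fgproj k,
    tens_hom (ahom_id P) (ahom_id Q) =1 ahom_id (tens_obj P Q);
  tens_comp : forall (P P' P'' Q Q' Q'' : fgproj k)
      (f' : ahom P' P'') (f : ahom P P') (g' : ahom Q' Q'') (g : ahom Q Q'),
    tens_hom (ahom_comp f' f) (ahom_comp g' g)
    =1 ahom_comp (tens_hom f' g') (tens_hom f g);
  tens_linl : forall (P P' Q Q' : fgproj k) (c : k) (f f' : ahom P P') (g : ahom Q Q'),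
    tens_hom (ahom_lincomb c f f') g
    =1 ahom_lincomb c (tens_hom f g) (tens_hom f' g);
  tens_linr : forall (P P' Q Q' : fgproj k) (c : k) (f : ahom P P') (g g' : ahom Q Q'),
    tens_hom f (ahom_lincomb c g g')
    =1 ahom_lincomb c (tens_hom f g) (tens_hom f g');
  tens_Pn : forall n m : nat,
    ahom (tens_obj (Pfg k n) (Pfg k m)) (Pfg k (n + m));
  tens_Pn_bij : forall n m : nat, bijective (tens_Pn n m);
  tens_diagram : forall a b : diagram,
    ahom_comp (tens_Pn (dright a) (dright b)) (tens_hom (rmul k a) (rmul k b))
    =1 ahom_comp (rmul k (dtens a b)) (tens_Pn (dleft a) (dleft b)) }.

(* The symbols [P] range over a large type, so K_0 cannot be given a zmodType
   structure, whose carrier must live in the universe of the carriers of modules. It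
   is constructed as the quotient of formal expressions by the congruence
   generated by the axioms of abelian groups and the relations
   [P] = [P'] + [P'']. *)
Inductive K0_expr (k : fieldType) : Type :=
| K0_gen of fgproj k
| K0_zeroe
| K0_adde of K0_expr k & K0_expr k
| K0_oppe of K0_expr k.
Arguments K0_zeroe {k}.

Inductive K0_eq (k : fieldType) : K0_expr k -> K0_expr k -> Prop :=
| K0_refl e : K0_eq e e
| K0_sym e f : K0_eq e f -> K0_eq f e
| K0_trans e f g : K0_eq e f -> K0_eq f g -> K0_eq e g
| K0_addec e e' f f' :
    K0_eq e e' -> K0_eq f f' -> K0_eq (K0_adde e f) (K0_adde e' f')
| K0_oppec e e' : K0_eq e e' -> K0_eq (K0_oppe e) (K0_oppe e')
| K0_addeA e f g : K0_eq (K0_adde e (K0_adde f g)) (K0_adde (K0_adde e f) g)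
| K0_addeC e f : K0_eq (K0_adde e f) (K0_adde f e)
| K0_add0e e : K0_eq (K0_adde K0_zeroe e) e
| K0_addNe e : K0_eq (K0_adde (K0_oppe e) e) K0_zeroe
| K0_rel (P P' P'' : fgproj k) :
    aiso P (P' * P'')%type -> K0_eq (K0_gen P) (K0_adde (K0_gen P') (K0_gen P'')).

Definition K0 (k : fieldType) : Type :=
  {C : K0_expr k -> Prop | exists e, C = K0_eq e}.

Section K0Group.
Context (k : fieldType).

Definition K0_class (e : K0_expr k) : K0 k :=
  exist (fun C => exists e, C = K0_eq e) (K0_eq e) (ex_intro _ e erefl).
Definition K0_repr (x : K0 k) : K0_expr k := projT1 (cid (proj2_sig x)).

Lemma K0_reprK x : K0_class (K0_repr x) = x.
Proof.
case: x => C HC; rewrite /K0_repr /=; case: (cid HC) => e /= E; subst C.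
by rewrite /K0_class; congr exist; exact: Prop_irrelevance.
Qed.

Lemma K0_classP e f : K0_class e = K0_class f <-> K0_eq e f.
Proof.
split=> [[E]|H]; first by rewrite E; exact: K0_refl.
have E : K0_eq e = K0_eq f.
  apply: funext => g; apply: propext; split=> H'.
    exact: K0_trans (K0_sym H) H'.
  exact: K0_trans H H'.
rewrite /K0_class; move: (ex_intro _ e _) (ex_intro _ f _); rewrite E => p q.
by congr exist; exact: Prop_irrelevance.
Qed.

Definition K0_zero : K0 k := K0_class K0_zeroe.
Definition K0_add (x y : K0 k) : K0 k := K0_class (K0_adde (K0_repr x) (K0_repr y)).
Definition K0_opp (x : K0 k) : K0 k := K0_class (K0_oppe (K0_repr x)).
Definition K0_cls (P : fgproj k) : K0 k := K0_class (K0_gen P).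

Lemma K0_add_class e f : K0_add (K0_class e) (K0_class f) = K0_class (K0_adde e f).
Proof. by apply/K0_classP/K0_addec; apply/K0_classP; rewrite K0_reprK. Qed.

Lemma K0_opp_class e : K0_opp (K0_class e) = K0_class (K0_oppe e).
Proof. by apply/K0_classP/K0_oppec; apply/K0_classP; rewrite K0_reprK. Qed.

End K0Group.
Arguments K0_zero {k}.

Record is_ring (R : Type) (zero : R) (opp : R -> R) (add : R -> R -> R)
    (one : R) (mul : R -> R -> R) : Prop := IsRing {
  ring_addA : associative add;
  ring_addC : commutative add;
  ring_add0 : left_id zero add;
  ring_addN : left_inverse zero opp add;
  ring_mulA : associative mul;
  ring_mul1l : left_id one mul;
  ring_mul1r : right_id one mul;
  ring_mulDl : left_distributive mul add;
  ring_mulDr : right_distributive mul add }.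

(* The resolution is indexed by all of nat, and vanishes beyond [res_len]:
   [res_exact] in degree res_len then is injectivity of the last map. *)
Record resolution (k : fieldType) (M : amodType k) := Resolution {
  res_len : nat;
  res_obj : nat -> fgproj k;
  res_d : forall i, ahom (res_obj i.+1) (res_obj i);
  res_aug : ahom (res_obj 0) M;
  res_zero : forall i, (res_len < i)%N -> forall x : res_obj i, x = 0;
  res_aug_surj : forall y : M, exists x, res_aug x = y;
  res_exact0 : forall x : res_obj 0, res_aug x = 0 <-> exists z, res_d 0 z = x;
  res_exact : forall i (x : res_obj i.+1),
    res_d i x = 0 <-> exists z, res_d i.+1 z = x }.

Definition res_class (k : fieldType) (M : amodType k) (R : resolution M) : K0 k :=
  \big[@K0_add k/K0_zero]_(i < (res_len R).+1)
    (if odd i then K0_opp (K0_cls (res_obj R i)) else K0_cls (res_obj R i)).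

(* Main.v *)
From HB Require Import structures.
Require Import Defs.
From mathcomp Require Import all_boot all_order all_algebra.
From mathcomp Require Import finmap boolp zify ring.
From mathcomp.multinomials Require Import monalg.
Set Implicit Arguments.
Unset Strict Implicit.
Unset Printing Implicit Defensive.
Import Defs GRing.Theory.
Local Open Scope ring_scope.

(* The number of sarcs grades A^-, with degree 0 part spanned by the 1_n.
   Projectives: choose a surjection f from F = (+)_i P_{n_i} onto P with the
   number of summands minimal, and a section s of it. An entry of 1 - s f with a
   nonzero 1_n-coefficient would make a generator redundant, so all entries have
   positive degree; being idempotent, 1 - s f has entries of arbitrarily high
   degree, hence vanishes and P is isomorphic to F. The multiset of the n_i is an
   invariant, because the 1_n-coefficients of an isomorphism and of its inverse
   form inverse matrices. So P |-> sum_i x^(n_i) induces K_0 = Z[x], which is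
   multiplicative since a bilinear bifunctor commutes with finite direct sums.
   Standard modules: let N(n, a) be P_n modulo the diagrams with a right sarc
   among the first a points; inserting a right sarc at the point a yields
     0 -> N(n, a) -> N(n+1, a) -> N(n+1, a+1) -> 0,
   so [N(n, a)] = (x-1)^a x^(n-a) by induction on a, and N(n, n) = M_n. That the
   class does not depend on the resolution is Schanuel's lemma. *)

(** The grading does the work of a radical. $A^-$ has diagrams with arbitrarily many sarcs, so high
    degree alone does not force an element to vanish; but a diagram in $1_nA^-1_m$ has at most $n+m$
    sarcs. This is why generators, relations and matrix entries are kept homogeneous for the
    idempotents on both sides. The product on $K_0$ is transported from $\mathbb{Z}[x]$ along the
    rank, so the ring axioms cost nothing and a given tensor product enters only through
    $\mathrm{rk}(P\otimes Q)=\mathrm{rk}\,P\cdot\mathrm{rk}\,Q$. That a tensor product exists is a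
    separate construction: Kronecker products of matrices over $A^-$, after a choice of free forms.
    The modules $N(n,a)$ and the kernels met on the way need not be projective, hence have no class
    in $K_0$ by definition. The Euler characteristic is therefore a relation between a module and a
    polynomial, shown afterwards to be single-valued. The factor $x-1$ arises by subtracting the
    polynomial of $N(n,a)$ from that of $N(n+1,a)$. *)

(** * Homomorphisms, isomorphisms and direct sums of modules *)

Section Homs.
Context (k : fieldType).
Implicit Types M N L : amodType k.

(** Leibniz equality allows rewriting inside [tens_hom], which is not assumed to respect pointwise
    equality. The proofs packed with the maps are identified by proof irrelevance. *)
Lemma ahom_ext M N (f g : ahom M N) : f =1 g -> f = g.
Proof.
case: f => [[f [[fD] [fZ]]] fa]; case: g => [[g [[gD] [gZ]]] ga] /= E.
have E' : f = g by apply: funext.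
subst g; rewrite (Prop_irrelevance gD fD) (Prop_irrelevance gZ fZ).
by congr AHom; exact: Prop_irrelevance.
Qed.

Lemma ahomL M N (f : ahom M N) c x y : f (c *: x + y) = c *: f x + f y.
Proof. exact: linearP. Qed.
Lemma ahomD M N (f : ahom M N) x y : f (x + y) = f x + f y.
Proof. exact: linearD. Qed.
Lemma ahomB M N (f : ahom M N) x y : f (x - y) = f x - f y.
Proof. exact: linearB. Qed.
Lemma ahomN M N (f : ahom M N) x : f (- x) = - f x.
Proof. exact: linearN. Qed.
Lemma ahom_f0 M N (f : ahom M N) : f 0 = 0.
Proof. exact: linear0. Qed.
Lemma ahom_sum M N (f : ahom M N) (I : Type) (r : seq I) P (F : I -> M) :
  f (\sum_(i <- r | P i) F i) = \sum_(i <- r | P i) f (F i).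
Proof. exact: linear_sum. Qed.

Section Of.
Context M N (f : M -> N) (fl : linear f).
Definition linear_of : {linear M -> N} :=
  HB.pack f (GRing.isLinear.Build k M N _ f fl).
Definition ahom_of (fa : forall a x, f (act a x) = act a (f x)) : ahom M N :=
  @AHom k M N linear_of fa.
End Of.

Lemma ahom0_linear M N : linear (fun _ : M => 0 : N).
Proof. by move=> c x y; rewrite scaler0 addr0. Qed.
Lemma ahom0_act M N (a : Aminus k) (x : M) : 0 = act a (0 : N).
Proof. by rewrite act0r. Qed.
Definition ahom0 M N : ahom M N := ahom_of (@ahom0_linear M N) (@ahom0_act M N).

Definition ahom_add M N (f g : ahom M N) : ahom M N := ahom_lincomb 1 f g.

Lemma ahom_addE M N (f g : ahom M N) x : ahom_add f g x = f x + g x.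
Proof. by rewrite /= scale1r. Qed.

Lemma ahom_inv M N (f : ahom M N) : bijective f ->
  exists g : ahom N M, cancel f g /\ cancel g f.
Proof.
move=> [g fK gK].
have gl : linear g by move=> c x y; rewrite -{1}[x]gK -{1}[y]gK -linearP fK.
have ga a x : g (act a x) = act a (g x) by rewrite -{1}[x]gK -ahom_act fK.
by exists (ahom_of gl ga).
Qed.

Lemma ahom_bij M N (f : ahom M N) :
  (forall x, f x = 0 -> x = 0) -> (forall y, exists x, f x = y) -> bijective f.
Proof.
move=> inj sur; pose g y := projT1 (cid (sur y)).
have gK : cancel g f by move=> y; rewrite /g; case: cid.
exists g => // x; apply/eqP; rewrite -subr_eq0; apply/eqP/inj.
by rewrite linearB /= gK subrr.
Qed.

Lemma aiso_refl M : aiso M M.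
Proof. by exists (ahom_id M); exists id. Qed.
Lemma aiso_sym M N : aiso M N -> aiso N M.
Proof. by move=> [f /ahom_inv[g [fK gK]]]; exists g; exists f. Qed.
Lemma aiso_trans M N L : aiso M N -> aiso N L -> aiso M L.
Proof. by move=> [f fb] [g gb]; exists (ahom_comp g f); exact: bij_comp. Qed.

Lemma ahom_fst_linear M N : linear (fst : M * N -> M).
Proof. by []. Qed.
Lemma ahom_snd_linear M N : linear (snd : M * N -> N).
Proof. by []. Qed.
Definition ahom_fst M N : ahom (M * N)%type M :=
  ahom_of (@ahom_fst_linear M N) (fun _ _ => erefl).
Definition ahom_snd M N : ahom (M * N)%type N :=
  ahom_of (@ahom_snd_linear M N) (fun _ _ => erefl).

Section Pair.
Context M N L (f : ahom L M) (g : ahom L N).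
Definition pair_fun x : (M * N)%type := (f x, g x).
Lemma pair_linear : linear pair_fun.
Proof. by move=> c x y; rewrite /pair_fun !linearP. Qed.
Lemma pair_act a x : pair_fun (act a x) = act a (pair_fun x).
Proof. by rewrite /pair_fun !ahom_act. Qed.
Definition ahom_pair : ahom L (M * N)%type := ahom_of pair_linear pair_act.
End Pair.

Definition ahom_inl M N : ahom M (M * N)%type := ahom_pair (ahom_id M) (ahom0 M N).
Definition ahom_inr M N : ahom N (M * N)%type := ahom_pair (ahom0 N M) (ahom_id N).

Definition ahom_copair M N L (f : ahom M L) (g : ahom N L) : ahom (M * N)%type L :=
  ahom_add (ahom_comp f (ahom_fst M N)) (ahom_comp g (ahom_snd M N)).

Lemma ahom_copairE M N L (f : ahom M L) (g : ahom N L) x :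
  ahom_copair f g x = f x.1 + g x.2.
Proof. exact: ahom_addE. Qed.

Lemma aiso_prod M N M' N' : aiso M M' -> aiso N N' -> aiso (M * N)%type (M' * N')%type.
Proof.
move=> [f [f' fK f'K]] [g [g' gK g'K]].
exists (ahom_pair (ahom_comp f (ahom_fst M N)) (ahom_comp g (ahom_snd M N))).
by exists (fun x => (f' x.1, g' x.2)) => -[x y]; rewrite /= /pair_fun /= ?fK ?gK ?f'K ?g'K.
Qed.

Lemma act_sum M (I : Type) (r : seq I) P a (F : I -> M) :
  act a (\sum_(i <- r | P i) F i) = \sum_(i <- r | P i) act a (F i).
Proof. by apply: (big_morph (act a)); [exact: actDr | exact: act0r]. Qed.

Lemma actDl M a b (x : M) : act (a + b) x = act a x + act b x.
Proof. by have := act_linl 1 a b x; rewrite !scale1r. Qed.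
Lemma actZl M c a (x : M) : act (c *: a) x = c *: act a x.
Proof. by have := act_linl c a 0 x; rewrite act0l !addr0. Qed.

End Homs.

Lemma afingen_fin (k : fieldType) (M : amodType k) (I : finType) (m : I -> M) :
  (forall x, exists a : I -> Aminus k, x = \sum_i act (a i) (m i)) -> afingen M.
Proof.
move=> H; exists [seq m i | i <- enum I] => x; have [a E] := H x.
pose t j := tnth (in_tuple (enum I)) (cast_ord (size_map m (enum I)) j).
exists (fun j => a (t j)); rewrite {1}E -big_enum big_tnth /=.
rewrite (reindex (cast_ord (size_map m (enum I)))) /=; last first.
  exists (cast_ord (esym (size_map m (enum I)))) => j _; [exact: cast_ordK|exact: cast_ordKV].
apply: eq_bigr => j _; rewrite -/(t j); congr (act _ _); rewrite (nth_map (t j)).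
  by congr (m _); exact: tnth_nth.
by have := ltn_ord j; rewrite {2}size_map.
Qed.

(** * Finite direct sums of the modules $P_n$ *)

Section FreeModule.
Context (k : fieldType) (I : finType) (nu : I -> nat).

(** The direct sum of the $P_{\nu_i}$, as families of elements of $A^-$. With an arbitrary finite
    index type, direct sums are indexed by [I + J] and tensor products by [I * J], without
    renumbering. *)
Definition Fmod_pred : {pred {ffun I -> Aminus k}} :=
  fun f => [forall i, mulA (f i) (idA k (nu i)) == f i].

Lemma Fmod_pred_submod : submod_closed Fmod_pred.
Proof.
split=> [|c f g]; rewrite !unfold_in.
  by apply/forallP => i; rewrite ffunE mul0A.
move=> /forallP Hf /forallP Hg; apply/forallP => i.
by rewrite !ffunE mulA_linl (eqP (Hf i)) (eqP (Hg i)).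
Qed.
HB.instance Definition _ :=
  GRing.isSubmodClosed.Build k {ffun I -> Aminus k} Fmod_pred Fmod_pred_submod.

Record Fmod := MkFmod { Fmod_val : {ffun I -> Aminus k}; Fmod_valP : Fmod_val \in Fmod_pred }.
HB.instance Definition _ := [isSub for Fmod_val].
HB.instance Definition _ := [Choice of Fmod by <:].
HB.instance Definition _ := [SubChoice_isSubLmodule of Fmod by <:].

Definition fcoord (x : Fmod) (i : I) : Aminus k := Fmod_val x i.

Lemma fcoord_id x i : mulA (fcoord x i) (idA k (nu i)) = fcoord x i.
Proof. have /forallP/(_ i)/eqP := Fmod_valP x; exact. Qed.

Lemma fcoordP x y : fcoord x =1 fcoord y -> x = y.
Proof. by move=> E; apply: val_inj; apply/ffunP => i; exact: (E i). Qed.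

Lemma Fmod_of_subproof (f : I -> Aminus k) :
  [ffun i => mulA (f i) (idA k (nu i))] \in Fmod_pred.
Proof. by rewrite unfold_in; apply/forallP => i; rewrite ffunE -mulAA mulA_id eqxx. Qed.
(** The idempotents project any family onto the module, so vectors can be written down without side
    conditions. *)
Definition Fmod_of f : Fmod := MkFmod (Fmod_of_subproof f).

Lemma fcoord_of f i : fcoord (Fmod_of f) i = mulA (f i) (idA k (nu i)).
Proof. by rewrite /fcoord /= ffunE. Qed.

Lemma fcoordL c x y i : fcoord (c *: x + y) i = c *: fcoord x i + fcoord y i.
Proof.
have E := linearP (val : Fmod -> {ffun I -> Aminus k}) c x y.
by rewrite /fcoord -[Fmod_val _]/(val _) E !ffunE.
Qed.
Lemma fcoordD x y i : fcoord (x + y) i = fcoord x i + fcoord y i.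
Proof. by have := fcoordL 1 x y i; rewrite !scale1r. Qed.
Lemma fcoord0 i : fcoord 0 i = 0.
Proof. by have := fcoordL (-1) 0 0 i; rewrite scaler0 addr0 scaleN1r addNr. Qed.
Lemma fcoordB x y i : fcoord (x - y) i = fcoord x i - fcoord y i.
Proof. by have := fcoordL (-1) y x i; rewrite !scaleN1r ![- _ + _]addrC. Qed.
Lemma fcoord_sum (J : Type) (r : seq J) P (F : J -> Fmod) i :
  fcoord (\sum_(j <- r | P j) F j) i = \sum_(j <- r | P j) fcoord (F j) i.
Proof.
by apply: (big_morph (fun x => fcoord x i)) => [x y|]; [exact: fcoordD|exact: fcoord0].
Qed.

Definition Fmod_act (a : Aminus k) (x : Fmod) : Fmod := Fmod_of (fun i => mulA a (fcoord x i)).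

Lemma fcoord_act a x i : fcoord (Fmod_act a x) i = mulA a (fcoord x i).
Proof. by rewrite fcoord_of -mulAA fcoord_id. Qed.

Lemma Fmod_act_linl c (a b : Aminus k) x :
  Fmod_act (c *: a + b) x = c *: Fmod_act a x + Fmod_act b x.
Proof. by apply: fcoordP => i; rewrite fcoordL !fcoord_act mulA_linl. Qed.
Lemma Fmod_act_linr (a : Aminus k) c x y :
  Fmod_act a (c *: x + y) = c *: Fmod_act a x + Fmod_act a y.
Proof. by apply: fcoordP => i; rewrite !(fcoordL, fcoord_act) mulA_linr. Qed.
Lemma Fmod_actM (a b : Aminus k) x : Fmod_act (mulA a b) x = Fmod_act a (Fmod_act b x).
Proof. by apply: fcoordP => i; rewrite !fcoord_act mulAA. Qed.
Lemma Fmod_act_unital x : exists N, x = \sum_(n < N) Fmod_act (idA k n) x.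
Proof.
have H i : exists N0, forall N, (N0 <= N)%N ->
    fcoord x i = \sum_(n < N) mulA (idA k n) (fcoord x i).
  have [N0 HN] := act_unital_ge (MkPn (introT eqP (fcoord_id x i))).
  exists N0 => N /HN /(congr1 (val : Pn k (nu i) -> Aminus k)).
  by rewrite raddf_sum.
pose b i := projT1 (cid (H i)).
exists (\max_i b i)%N; apply: fcoordP => i; rewrite fcoord_sum.
under [RHS]eq_bigr do rewrite fcoord_act.
have lb : (b i <= \max_i b i)%N by apply: leq_bigmax.
by move: lb; rewrite {1}/b; case: cid => N HN /= /HN.
Qed.

HB.instance Definition _ := isAModule.Build k Fmod
  Fmod_act_linl Fmod_act_linr Fmod_actM Fmod_act_unital.

Lemma fcoord_actE a (x : Fmod) i : fcoord (act a x) i = mulA a (fcoord x i).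
Proof. exact: fcoord_act. Qed.

Definition fone (i : I) : Fmod := Fmod_of (fun j => if j == i then idA k (nu i) else 0).

Lemma fcoord_one i j : fcoord (fone i) j = if j == i then idA k (nu i) else 0.
Proof.
by rewrite fcoord_of; case: eqP => [->|_]; rewrite ?mulA_id ?eqxx ?mul0A.
Qed.

Lemma fone_id i : act (idA k (nu i)) (fone i) = fone i.
Proof.
apply: fcoordP => j; rewrite fcoord_actE fcoord_one.
by case: eqP; rewrite ?mulA_id ?eqxx ?mulA0.
Qed.

Lemma Fmod_basis x : x = \sum_i act (fcoord x i) (fone i).
Proof.
apply: fcoordP => j; rewrite fcoord_sum (bigD1 j) //= big1.
  by rewrite fcoord_actE fcoord_one eqxx fcoord_id addr0.
by move=> i /negbTE ne; rewrite fcoord_actE fcoord_one eq_sym ne mulA0.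
Qed.

Section Fhom.
Context (M : amodType k) (m : I -> M).
(** The generator [fone i] goes to $1_{\nu_i}m_i$, so every family [m] defines a homomorphism, which
    hits $m_i$ itself when $1_{\nu_i}m_i=m_i$. *)
Definition Fhom_fun (x : Fmod) : M := \sum_i act (fcoord x i) (m i).
Lemma Fhom_linear : linear Fhom_fun.
Proof.
move=> c x y; rewrite /Fhom_fun scaler_sumr -big_split; apply: eq_bigr => i _.
by rewrite fcoordL act_linl.
Qed.
Lemma Fhom_act a x : Fhom_fun (act a x) = act a (Fhom_fun x).
Proof.
by rewrite /Fhom_fun act_sum; apply: eq_bigr => i _; rewrite fcoord_actE actM.
Qed.
Definition Fhom : ahom (Fmod : amodType k) M := ahom_of Fhom_linear Fhom_act.

Lemma FhomE x : Fhom x = \sum_i act (fcoord x i) (m i).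
Proof. by []. Qed.

Lemma Fhom_one i : Fhom (fone i) = act (idA k (nu i)) (m i).
Proof.
rewrite FhomE (bigD1 i) //= big1; first by rewrite fcoord_one eqxx addr0.
by move=> j /negbTE ne; rewrite fcoord_one ne act0l.
Qed.
End Fhom.

Lemma ahom_Fmod (M : amodType k) (f : ahom (Fmod : amodType k) M) x :
  f x = \sum_i act (fcoord x i) (f (fone i)).
Proof.
by rewrite {1}[x]Fmod_basis raddf_sum; apply: eq_bigr => i _; exact: ahom_act.
Qed.

Lemma ahom_Fmod_ext (M : amodType k) (f g : ahom (Fmod : amodType k) M) :
  (forall i, f (fone i) = g (fone i)) -> f =1 g.
Proof. by move=> E x; rewrite !ahom_Fmod; apply: eq_bigr => i _; rewrite E. Qed.

Lemma Fmod_fingen : afingen (Fmod : amodType k).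
Proof. by apply: (@afingen_fin _ _ I fone) => x; exists (fcoord x); exact: Fmod_basis. Qed.

Lemma Fmod_proj : aprojective (Fmod : amodType k).
Proof.
move=> M N p g sp; pose m i := projT1 (cid (sp (g (fone i)))).
have mE i : p (m i) = g (fone i) by rewrite /m; case: cid.
exists (Fhom m); apply: (@ahom_Fmod_ext _ (ahom_comp p (Fhom m)) g) => i.
by rewrite [LHS](congr1 p (Fhom_one m i)) ahom_act mE -ahom_act fone_id.
Qed.

Definition Ffg : fgproj k := FGProj Fmod_proj Fmod_fingen.

End FreeModule.
Arguments Fhom {k I nu M} m.
Arguments FhomE {k I nu M} m x.
Arguments Fhom_one {k I nu M} m i.

(** * Degrees of diagrams *)

Section Degree.
Local Open Scope fset_scope.
Implicit Types d y z : diagram.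

Definition width d : nat := #|` larcs d|.
Definition lends d : {fset nat} := [fset p.1 | p in larcs d].
Definition rends d : {fset nat} := [fset p.2 | p in larcs d].

Lemma lendsP d i : reflect (exists j, (i, j) \in larcs d) (i \in lends d).
Proof.
apply: (iffP (imfsetP _ _ _ _)) => /= [[[a b] H ->]|[j H]]; first by exists b.
by exists (i, j).
Qed.
Lemma rendsP d j : reflect (exists i, (i, j) \in larcs d) (j \in rends d).
Proof.
apply: (iffP (imfsetP _ _ _ _)) => /= [[[a b] H ->]|[i H]]; first by exists a.
by exists (i, j).
Qed.

Lemma card_lends d : #|` lends d| = width d.
Proof.
apply: card_in_imfset => -[a b] [a' b'] /= H H' E.
by rewrite E in H *; rewrite (larcs_inj_l H H').
Qed.
Lemma card_rends d : #|` rends d| = width d.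
Proof.
apply: card_in_imfset => -[a b] [a' b'] /= H H' E.
by rewrite E in H *; rewrite (larcs_inj_r H H').
Qed.

Definition below n : {fset nat} := [fset i in iota 0 n].
Lemma in_below n i : (i \in below n) = (i < n)%N.
Proof. by rewrite in_fset mem_iota. Qed.
Lemma card_below n : #|` below n| = n.
Proof. by rewrite card_fseq undup_id ?size_iota // iota_uniq. Qed.

Lemma lends_sub d : lends d `<=` below (dleft d).
Proof.
by apply/fsubsetP => i /lendsP[j /larcs_bound/andP[lt _]]; rewrite in_below.
Qed.
Lemma rends_sub d : rends d `<=` below (dright d).
Proof.
by apply/fsubsetP => i /rendsP[j /larcs_bound/andP[_ lt]]; rewrite in_below.
Qed.
Lemma width_left d : (width d <= dleft d)%N.
Proof. by rewrite -card_lends -[X in (_ <= X)%N]card_below fsubset_leq_card ?lends_sub. Qed.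
Lemma width_right d : (width d <= dright d)%N.
Proof. by rewrite -card_rends -[X in (_ <= X)%N]card_below fsubset_leq_card ?rends_sub. Qed.

(** Without floating arcs, every middle point is the end of a larc of [y] or of [z]. By
    inclusion-exclusion the claim becomes that the larcs of the concatenation are at most as many as
    the middle points where two larcs meet. *)
Lemma width_dcat y z : composable y z ->
  (width (dcat y z) + dright y <= width y + width z)%N.
Proof.
move=> /composableP[E H].
have U : rends y `|` lends z = below (dright y).
  apply/eqP; rewrite eqEfsubset fsubUset rends_sub {1}E lends_sub /=.
  apply/fsubsetP => j; rewrite in_below inE => /H[/rendsP->//|/lendsP->].
  by rewrite orbT.
rewrite -(card_rends y) -(card_lends z) -cardfsUI U card_below addnC leq_add2l.
pose Y := [fset p in larcs y | p.2 \in lends z].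
have cY : (#|` Y| <= #|` rends y `&` lends z|)%N.
  have <- : #|` [fset p.2 | p in Y]| = #|` Y|.
    apply: card_in_imfset => -[a b] [a' b']; rewrite !inE /= => /andP[h _] /andP[h' _] e.
    by rewrite e in h *; rewrite (larcs_inj_r h h').
  apply: fsubset_leq_card; apply/fsubsetP => j /imfsetP[[a b]] /=.
  rewrite !inE /= => /andP[h1 h2] ->; rewrite h2 andbT.
  by apply/rendsP; exists a.
apply: leq_trans cY; rewrite -card_lends.
apply: (@leq_trans #|` [fset p.1 | p in Y]|); last exact: leq_imfset_card.
apply: fsubset_leq_card; apply/fsubsetP => i /lendsP[l /larcs_catP[j [h1 h2]]].
apply/imfsetP; exists (i, j) => //=; rewrite !inE h1 /=.
by apply/lendsP; exists l.
Qed.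

(* The number of sarcs: every larc takes up two boundary points. *)
Definition degree d : nat := (dleft d + dright d - (width d).*2)%N.

(** No sarc gets lost: one at a middle point faces a larc, which carries it to the outer
    boundary. *)
Lemma degree_dcat y z : composable y z -> (degree y + degree z <= degree (dcat y z))%N.
Proof.
move=> C; have W := width_dcat C; have /composableP[E _] := C.
rewrite /degree -[dleft (dcat y z)]/(dleft y) -[dright (dcat y z)]/(dright z) -E -!addnn.
have := width_left y; have := width_right y; have := width_right z.
have := width_left z; rewrite -E.
move: (width _) (width _) (width _) (dleft y) (dright y) (dright z) W => a b c l m r.
lia.
Qed.

Lemma degree_le d : (degree d <= dleft d + dright d)%N.
Proof. exact: leq_subr. Qed.

(** With no sarcs the larcs form an order-preserving bijection of an initial segment, and this is
    the identity by strong induction. *)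
Lemma degree0 d : degree d = 0%N -> d = did (dleft d).
Proof.
move=> D; have := width_left d; have := width_right d.
move=> Wr Wl; have [El Er] : width d = dleft d /\ width d = dright d.
  move: D Wr Wl; rewrite /degree -addnn.
  move: (width d) (dleft d) (dright d) => a b c; lia.
have L : lends d = below (dleft d).
  by apply/eqP; rewrite eqEfcard lends_sub card_below card_lends El leqnn.
have R : rends d = below (dleft d).
  by apply/eqP; rewrite eqEfcard -{1}El {1}Er rends_sub card_below card_rends El leqnn.
have H i : (i < dleft d)%N -> (i, i) \in larcs d.
  elim/ltn_ind: i => i IH lt.
  have /lendsP[j Hj] : i \in lends d by rewrite L in_below.
  have /rendsP[i' Hi] : i \in rends d by rewrite R in_below.
  have E := larcs_mono Hi Hj; case: (ltngtP i j) => [lij|lji|e]; last by rewrite {2}e.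
    rewrite lij in E; have K := IH i' E (ltn_trans E lt).
    by have e := larcs_inj_l Hi K; rewrite e ltnn in E.
  by have K := IH j lji (ltn_trans lji lt); rewrite (larcs_inj_r Hj K) ltnn in lji.
apply: diagram_eq => //; first by rewrite -Er El.
apply/fsetP => -[i j]; rewrite larcs_idP; apply/idP/andP => [h|[/eqP<- /H //]].
have /andP[lt _] := larcs_bound h.
by rewrite (larcs_inj_l h (H i lt)) eqxx.
Qed.

Lemma degree_did n : degree (did n) = 0%N.
Proof.
rewrite /degree /=; suff -> : width (did n) = n by rewrite addnn subnn.
rewrite -card_lends -[RHS]card_below; congr (#|` _|); apply/fsetP => i.
rewrite in_below; apply/lendsP/idP => [[j]|lt].
  by rewrite larcs_idP => /andP[].
by exists i; rewrite larcs_idP eqxx.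
Qed.
End Degree.

(** * The degree filtration of $A^-$ and the coefficients of the $1_n$ *)

Section Filtration.
Context (k : fieldType).
Implicit Types a b : Aminus k.

Definition indeg N a := forall d, a@_d != 0 -> (N <= degree d)%N.

Lemma indeg0 N : indeg N 0.
Proof. by move=> d; rewrite mcoeff0 eqxx. Qed.
Lemma indegL N c a b : indeg N a -> indeg N b -> indeg N (c *: a + b).
Proof.
move=> Ha Hb d; rewrite mcoeffD mcoeffZ; have [->|/Ha //] := eqVneq a@_d 0.
by rewrite mulr0 add0r => /Hb.
Qed.
Lemma indegD N a b : indeg N a -> indeg N b -> indeg N (a + b).
Proof. by move=> Ha Hb; rewrite -[a]scale1r; apply: indegL. Qed.
Lemma indeg_sum N (I : Type) (r : seq I) (F : I -> Aminus k) :
  (forall i, indeg N (F i)) -> indeg N (\sum_(i <- r) F i).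
Proof. by move=> H; apply: big_rec => [|i a _ Ha]; [exact: indeg0|exact: indegD]. Qed.

Lemma mcoeff_basis d e : (basis k d)@_e = (d == e)%:R.
Proof. by rewrite /basis mcoeffU; case: eqP. Qed.

Lemma indegM N N' a b : indeg N a -> indeg N' b -> indeg (N + N') (mulA a b).
Proof.
move=> Ha Hb d; apply: contra_neqT => Hd; rewrite /mulA raddf_sum /= big_seq big1 // => y.
rewrite -mcoeff_neq0 => /Ha Hy; rewrite raddf_sum /= big_seq big1 // => z.
rewrite -mcoeff_neq0 => /Hb Hz; rewrite mcoeffZ /dmul.
case: ifP => C; last by rewrite mcoeff0 mulr0.
rewrite mcoeff_basis; case: eqP => [E|_]; last by rewrite mulr0.
by case/negP: Hd; rewrite -E (leq_trans _ (degree_dcat C)) // leq_add.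
Qed.

Lemma mcoeff_id_mul n a d : (mulA (idA k n) a)@_d = if dleft d == n then a@_d else 0.
Proof.
elim/Aminus_ind: a => [|e|c a b Ha Hb].
- by rewrite mulA0 mcoeff0 if_same.
- rewrite id_basis; case: (eqVneq e d) => [<-|ne].
    by case: ifP => // _; rewrite mcoeff0.
  by rewrite mcoeff_basis (negbTE ne) if_same; case: ifP; rewrite ?mcoeff0 // mcoeff_basis (negbTE ne).
- by rewrite mulA_linr !mcoeffD !mcoeffZ Ha Hb; case: ifP; rewrite // mulr0 addr0.
Qed.
Lemma mcoeff_mul_id n a d : (mulA a (idA k n))@_d = if dright d == n then a@_d else 0.
Proof.
elim/Aminus_ind: a => [|e|c a b Ha Hb].
- by rewrite mul0A mcoeff0 if_same.
- rewrite basis_id; case: (eqVneq e d) => [<-|ne].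
    by case: ifP => // _; rewrite mcoeff0.
  by rewrite mcoeff_basis (negbTE ne) if_same; case: ifP; rewrite ?mcoeff0 // mcoeff_basis (negbTE ne).
- by rewrite mulA_linl !mcoeffD !mcoeffZ Ha Hb; case: ifP; rewrite // mulr0 addr0.
Qed.

(** A diagram with $n$ left and $m$ right points has at most $n+m$ sarcs. *)
Lemma indeg_eq0 n m a : mulA (idA k n) a = a -> mulA a (idA k m) = a ->
  indeg (n + m).+1 a -> a = 0.
Proof.
move=> Hn Hm Ha; apply/malgP => d; rewrite mcoeff0; apply/eqP; apply: contraT => nz.
have := Ha d nz; rewrite ltnNge (leq_trans (degree_le d)) //.
move: nz; rewrite -{1}Hn mcoeff_id_mul; case: (dleft d =P n) => [->|]; last by rewrite eqxx.
by rewrite -{1}Hm mcoeff_mul_id; case: (dright d =P m) => [->|]; last by rewrite eqxx.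
Qed.

Definition eps n a : k := a@_(did n).

Lemma epsL n c a b : eps n (c *: a + b) = c * eps n a + eps n b.
Proof. by rewrite /eps mcoeffD mcoeffZ. Qed.
Lemma eps0 n : eps n 0 = 0.
Proof. exact: mcoeff0. Qed.
Lemma eps_sum n (I : Type) (r : seq I) P (F : I -> Aminus k) :
  eps n (\sum_(i <- r | P i) F i) = \sum_(i <- r | P i) eps n (F i).
Proof. exact: raddf_sum. Qed.
Lemma eps_id n m : eps n (idA k m) = (n == m)%:R.
Proof.
rewrite /eps mcoeff_basis eq_sym; congr (nat_of_bool _)%:R.
by apply/eqP/eqP => [/(congr1 dleft)|->].
Qed.

(* Products of diagrams other than the 1_n have positive degree, so the 1_n-coefficient is multiplicative. *)
Lemma epsM n a b : eps n (mulA a b) = eps n a * eps n b.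
Proof.
elim/Aminus_ind: a => [|y|c a a' IH IH']; first by rewrite mul0A eps0 mul0r.
  2: by rewrite mulA_linl !epsL IH IH' mulrDl mulrA.
elim/Aminus_ind: b => [|z|c b b' IH IH']; first by rewrite mulA0 eps0 mulr0.
  2: by rewrite mulA_linr !epsL IH IH' mulrDr !mulrA (mulrC c).
rewrite mulA_basis /eps !mcoeff_basis /dmul.
case: (eqVneq y (did n)) => [->|ny].
  rewrite composable_didl mul1r; case: (eqVneq (dleft z) n) => [E|ne].
    by rewrite -E did_catl mcoeff_basis E.
  rewrite mcoeff0; case: eqP => // E; by rewrite E eqxx in ne.
rewrite mul0r; case: ifP => C; last by rewrite mcoeff0.
rewrite mcoeff_basis; case: eqP => // E; case/eqP: ny.
have D := degree_dcat C; rewrite E degree_did leqn0 addn_eq0 in D.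
case/andP: D => /eqP/degree0 -> _.
by have -> : dleft y = n by have := congr1 dleft E.
Qed.

Lemma eps_homog n m p a : mulA (idA k m) a = a -> mulA a (idA k p) = a ->
  eps n a != 0 -> n = m /\ n = p.
Proof.
move=> Hm Hp; rewrite /eps => H; split.
  by move: H; rewrite -Hm mcoeff_id_mul; case: (dleft _ =P m) => //; rewrite eqxx.
by move: H; rewrite -Hp mcoeff_mul_id; case: (dright _ =P p) => //; rewrite eqxx.
Qed.

(** By [degree0], the diagrams of degree 0 are exactly those that the [eps n] read off. *)
Lemma indeg1 a : (forall n, eps n a = 0) -> indeg 1 a.
Proof.
move=> H d; rewrite lt0n; apply: contra_neqN => /eqP/degree0 E; rewrite E; exact: H.
Qed.

End Filtration.

(** * Decomposition of projectives *)

Section Decomposition.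
Context (k : fieldType).

Section Drop.
Context (P : amodType k) (r : nat) (nu : 'I_r.+1 -> nat) (x : 'I_r.+1 -> P).
Let f : ahom (Fmod k nu : amodType k) P := Fhom x.

(* If a relation among homogeneous generators has a coefficient c 1_n + (terms of
   positive degree), c != 0, then that generator is a combination of the others:
   iterating the relation pushes its coefficient into arbitrarily high degree. *)
Lemma drop_generator (j : 'I_r.+1) (u : Fmod k nu) :
  f u = 0 -> act (idA k (nu j)) u = u -> eps (nu j) (fcoord u j) != 0 ->
  (forall y, exists z, f z = y) ->
  forall y, exists z : Fmod k (nu \o lift j), Fhom (x \o lift j) z = y.
Proof.
move=> fu hu; set n := nu j; set c := eps n _ => nz sur.
(* [W] is the submodule generated by the generators other than that of index [j]; the aim is to show
   that it contains this one too. *)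
pose W y := exists2 g : Fmod k nu, fcoord g j = 0 & f g = y.
have WL d a b : W a -> W b -> W (d *: a + b).
  move=> [g g0 <-] [h h0 <-]; exists (d *: g + h); last by rewrite ahomL.
  by rewrite fcoordL g0 h0 scaler0 addr0.
have WA a y : W y -> W (act a y).
  move=> [g g0 <-]; exists (act a g); last by rewrite ahom_act.
  by rewrite fcoord_actE g0 mulA0.
pose xj := f (fone k nu j).
have split_j (g : Fmod k nu) : W (f g - act (fcoord g j) xj).
  exists (g - act (fcoord g j) (fone k nu j)); last by rewrite ahomB ahom_act.
  by rewrite fcoordB fcoord_actE fcoord_one eqxx fcoord_id subrr.
(* [R] is $1_nA^-1_n$, where degrees are bounded by $2n$. *)
pose R := [pred a : Aminus k | (mulA (idA k n) a == a) && (mulA a (idA k n) == a)].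
have RL d a b : a \in R -> b \in R -> d *: a + b \in R.
  move=> /andP[/eqP a1 /eqP a2] /andP[/eqP b1 /eqP b2].
  by rewrite inE mulA_linr mulA_linl a1 a2 b1 b2 !eqxx.
have RM a b : a \in R -> b \in R -> mulA a b \in R.
  move=> /andP[/eqP a1 /eqP a2] /andP[/eqP b1 /eqP b2].
  by rewrite inE mulAA a1 -mulAA b2 !eqxx.
have R1 : idA k n \in R by rewrite inE mulA_id eqxx eqxx.
have Ru : fcoord u j \in R by rewrite inE -fcoord_actE hu fcoord_id !eqxx.
have xjE : act (idA k n) xj = xj by rewrite -ahom_act fone_id.
have step1 : exists2 a, a \in R /\ indeg 1 a & W (xj - act a xj).
  (* With $a=1_n-c^{-1}u_j$ one has $x_j-ax_j=c^{-1}u_jx_j$, which lies in [W] because $f(u)=0$; the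
     scalar is chosen to cancel the $1_n$-coefficient of $a$. *)
  exists (- c^-1 *: fcoord u j + idA k n); last first.
    have := WL (- c^-1) _ 0 (split_j u) (ex_intro2 _ _ 0 (fcoord0 _ _ _) (ahom_f0 f)).
    by rewrite fu sub0r addr0 actDl actZl xjE scalerN !scaleNr opprD opprK addrC subrK.
  split; first exact: RL.
  apply: indeg1 => m; rewrite epsL eps_id.
  have [->|ne] := eqVneq m n; first by rewrite mulNr mulVf // addNr.
  rewrite addr0; apply/eqP; rewrite mulf_eq0; apply/orP; right.
  apply: contraNT ne; case/andP: Ru => /eqP h1 /eqP h2 /(eps_homog h1 h2)[-> _].
  exact: eqxx.
have stepN N : exists2 a, a \in R /\ indeg N.+1 a & W (xj - act a xj).
  elim: N => [//|N [a [aR aD] aW]]; have [b [bR bD] bW] := step1.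
  exists (mulA a b); first by split; [exact: RM|rewrite -addn1; exact: indegM].
  rewrite actM; have -> : xj - act a (act b xj) = 1 *: (xj - act a xj) + act a (xj - act b xj).
    by rewrite scale1r actDr -[- act b xj]scaleN1r actZr scaleN1r addrA subrK.
  by apply: (WL); last exact: (WA).
have Wj : W xj.
  (* Degree at least $2n+1$ is impossible in $1_nA^-1_n$, so $a=0$. *)
  have [a [/andP[/eqP a1 /eqP a2] aD]] := stepN (n + n)%N.
  by rewrite (indeg_eq0 a1 a2 aD) act0l subr0.
move=> y; have [g gy] := sur y.
have [h h0 hy] : W y.
  by rewrite -gy -[f g](subrK (act (fcoord g j) xj)) -[_ - _]scale1r; apply: WL; [|exact: WA].
exists (Fmod_of _ (fun i => fcoord h (lift j i))).
rewrite -hy /f !FhomE [RHS](bigD1_ord j) //= h0 act0l add0r.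
by apply: eq_bigr => i _; rewrite fcoord_of fcoord_id.
Qed.
End Drop.

Definition generated (P : amodType k) r := exists (nu : 'I_r -> nat) (x : 'I_r -> P),
  forall y, exists z : Fmod k nu, Fhom x z = y.

Lemma drop_generated (P : amodType k) r (nu : 'I_r -> nat) (x : 'I_r -> P) j (u : Fmod k nu) :
  Fhom x u = 0 -> act (idA k (nu j)) u = u -> eps (nu j) (fcoord u j) != 0 ->
  (forall y, exists z : Fmod k nu, Fhom x z = y) -> generated P r.-1.
Proof.
case: r nu x j u => [nu x [] //|r] nu x j u fu hu nz sur.
by exists (nu \o lift j), (x \o lift j); exact: drop_generator fu hu nz sur.
Qed.

(** Arbitrary generators $s_i$ are replaced by their homogeneous components $1_ns_i$, indexed by the
    pairs $(i,n)$ with $n$ below a common bound. *)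
Lemma afingen_generated (P : amodType k) : afingen P -> exists r, generated P r.
Proof.
move=> [s Hs].
have H i : exists N0, forall N, (N0 <= N)%N -> s`_i = \sum_(n < N) act (idA k n) s`_i.
  exact: act_unital_ge.
pose b i := projT1 (cid (H i)); pose N := (\max_(i < size s) b i)%N.
have HN (i : 'I_(size s)) : s`_i = \sum_(n < N) act (idA k n) s`_i.
  have : (b i <= N)%N by apply: (@leq_bigmax _ (fun i : 'I_(size s) => b i)).
  by rewrite {1}/b; case: cid => M HM /= /HM.
pose I : finType := ('I_(size s) * 'I_N)%type.
pose ev i : 'I_(size s) * 'I_N := @enum_val I predT i.
exists #|I|, (fun i => (ev i).2 : nat), (fun i => s`_((ev i).1)) => y.
have [a E] := Hs y.
exists (Fmod_of _ (fun i => a (ev i).1)).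
rewrite FhomE E; under [RHS]eq_bigr => i _ do rewrite {1}(HN i) act_sum.
rewrite pair_big [RHS](reindex (@enum_val I predT)) /=; last exact/onW_bij/enum_val_bij.
by apply: eq_bigr => i _; rewrite fcoord_of actM.
Qed.

Lemma fgproj_free (P : fgproj k) :
  exists r (nu : 'I_r -> nat), aiso (Fmod k nu : amodType k) P.
Proof.
have H : exists r, `[< generated P r >].
  by have [r Hr] := afingen_generated (fgproj_fin P); exists r; apply/asboolP.
case: (ex_minnP H) => r /asboolP[nu [x sur]] rmin; exists r, nu.
pose f := Fhom x : ahom (Fmod k nu : amodType k) P.
have [s sK] := fgproj_proj (ahom_id P) sur.
exists f; apply: ahom_bij => // y fy0.
(* [E] is the idempotent $1-sf$, which fixes the kernel of [f]: injectivity of [f] amounts to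
   $E=0$. *)
pose E : ahom (Fmod k nu : amodType k) (Fmod k nu) := ahom_lincomb (-1) (ahom_comp s f) (ahom_id _).
have EE z : E z = z - s (f z) by rewrite /= scaleN1r addrC.
have fE z : f (E z) = 0 by rewrite EE ahomB (sK (f z)) subrr.
have EEE z : E (E z) = E z by rewrite EE fE ahom_f0 subr0.
pose e i j := fcoord (E (fone k nu i)) j.
have e1 i j : mulA (idA k (nu i)) (e i j) = e i j.
  by rewrite /e -fcoord_actE -ahom_act fone_id.
have e2 i j : mulA (e i j) (idA k (nu j)) = e i j by rewrite /e fcoord_id.
(* As [f] kills the image of [E], each row of [E] is a relation among the generators; a nonzero
   $1_n$-coefficient in it would remove a generator, against the minimality of [r]. *)
have rad i j n : eps n (e i j) = 0.
  apply/eqP; apply: contraT => nz; have [ni nj] := eps_homog (e1 i j) (e2 i j) nz.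
  have r0 : (0 < r)%N by apply: leq_ltn_trans (ltn_ord i).
  have hu : act (idA k (nu j)) (E (fone k nu i)) = E (fone k nu i).
    by rewrite -nj ni -ahom_act fone_id.
  rewrite nj in nz; have /asboolP/rmin := drop_generated (fE _) hu nz sur.
  by rewrite -ltnS prednK // ltnn.
have D N : forall i j, indeg N.+1 (e i j).
  elim: N => [|N IH] i j; first by apply: indeg1 => n; exact: rad.
  (* From $E=E^2$, $e_{ij}=\sum_l e_{il}e_{lj}$, and the first factor of each product adds one to
     the degree. *)
  rewrite /e -EEE ahom_Fmod fcoord_sum; apply: indeg_sum => l.
  by rewrite fcoord_actE -add1n; apply: indegM; [apply: indeg1 => n; exact: rad|exact: IH].
have E0 : E y = 0.
  rewrite ahom_Fmod big1 // => i _; have -> : E (fone k nu i) = 0; last by rewrite act0r.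
  by apply: fcoordP => j; rewrite fcoord0; apply: indeg_eq0 (e1 i j) (e2 i j) (D _ _ _).
by move: E0; rewrite EE fy0 ahom_f0 subr0.
Qed.

(** Applying the multiplicative [eps n] to the entries of an isomorphism and its inverse, only the
    indices with value $n$ contribute. This gives rectangular matrices over $\mathbf{k}$ with
    $AB=1$, so $A$ has at most as many rows as columns. *)
Lemma aiso_card_le (I J : finType) (nu : I -> nat) (mu : J -> nat) n :
  aiso (Fmod k nu : amodType k) (Fmod k mu) ->
  (#|[pred i | nu i == n]| <= #|[pred j | mu j == n]|)%N.
Proof.
move=> [f /ahom_inv[g [fK _]]].
pose a i j := fcoord (f (fone k nu i)) j; pose b j i := fcoord (g (fone k mu j)) i.
have ab i i' : \sum_j mulA (a i j) (b j i') = if i' == i then idA k (nu i) else 0.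
  rewrite -fcoord_one -(fK (fone k nu i)) [X in _ = fcoord X _]ahom_Fmod fcoord_sum.
  by apply: eq_bigr => j _; rewrite fcoord_actE.
pose A := \matrix_(i < #|[pred i | nu i == n]|, j < #|[pred j | mu j == n]|)
  eps n (a (enum_val i) (enum_val j)).
pose B := \matrix_(j < #|[pred j | mu j == n]|, i < #|[pred i | nu i == n]|)
  eps n (b (enum_val j) (enum_val i)).
apply: (@mulmx1_min k _ _ A B); apply/matrixP => i i'; rewrite !mxE.
have /eqP nui : nu (enum_val i) == n by have := enum_valP i.
transitivity (eps n (\sum_j mulA (a (enum_val i) j) (b j (enum_val i')))); last first.
  rewrite ab (inj_eq enum_val_inj) eq_sym; case: eqP => _; last exact: eps0.
  by rewrite eps_id nui eqxx.
rewrite eps_sum (bigID [pred j | mu j == n]) /= [X in _ + X]big1 ?addr0; last first.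
  move=> j ne; rewrite epsM; have [->|nz] := eqVneq (eps n (a (enum_val i) j)) 0.
    by rewrite mul0r.
  have h1 : mulA (idA k (nu (enum_val i))) (a (enum_val i) j) = a (enum_val i) j.
    by rewrite -fcoord_actE -ahom_act fone_id.
  have [_ e] := eps_homog h1 (fcoord_id _ j) nz.
  by rewrite e eqxx in ne.
rewrite (big_enum_val (fun j => eps n (mulA (a (enum_val i) j) (b j (enum_val i'))))) /=.
by apply: eq_bigr => j _; rewrite epsM !mxE.
Qed.

Lemma aiso_card (I J : finType) (nu : I -> nat) (mu : J -> nat) n :
  aiso (Fmod k nu : amodType k) (Fmod k mu) ->
  #|[pred i | nu i == n]| = #|[pred j | mu j == n]|.
Proof.
by move=> H; apply/eqP; rewrite eqn_leq !aiso_card_le //; exact: aiso_sym.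
Qed.

End Decomposition.

(** * Isomorphisms between free modules, and the rank polynomial *)

Section FreeIsos.
Context (k : fieldType).

Section Single.
Context (I : finType) (nu : I -> nat) (i0 : I) (i0P : forall i, i = i0).
Definition single_fun (x : Fmod k nu) : Pn k (nu i0) := MkPn (introT eqP (fcoord_id x i0)).
Lemma single_linear : linear single_fun.
Proof. by move=> c x y; apply: val_inj; rewrite [RHS]Pn_valL; exact: fcoordL. Qed.
Lemma single_act a x : single_fun (act a x) = act a (single_fun x).
Proof. by apply: val_inj; exact: fcoord_actE. Qed.
Definition single : ahom (Fmod k nu : amodType k) (Pn k (nu i0)) :=
  ahom_of single_linear single_act.
Lemma single_bij : bijective single.
Proof.
exists (fun x => Fmod_of nu (fun=> Pn_val x)) => x.
  by apply: fcoordP => i; rewrite fcoord_of (i0P i) fcoord_id.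
by apply: val_inj; rewrite /= fcoord_of; exact/eqP/(Pn_valP x).
Qed.
End Single.

Section Restrict.
Context (I J : finType) (nu : J -> nat) (h : I -> J).
(** A relabelling when [h] is bijective, and the two projections of a direct sum when [h] is [inl]
    or [inr]. *)
Definition restrict_fun (x : Fmod k nu) : Fmod k (nu \o h) :=
  Fmod_of (nu \o h) (fun i => fcoord x (h i)).
Lemma fcoord_restrict x i : fcoord (restrict_fun x) i = fcoord x (h i).
Proof. by rewrite fcoord_of fcoord_id. Qed.
Lemma restrict_linear : linear restrict_fun.
Proof. by move=> c x y; apply: fcoordP => i; rewrite !(fcoordL, fcoord_restrict). Qed.
Lemma restrict_act a x : restrict_fun (act a x) = act a (restrict_fun x).
Proof. by apply: fcoordP => i; rewrite !(fcoord_actE, fcoord_restrict). Qed.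
Definition restrict : ahom (Fmod k nu : amodType k) (Fmod k (nu \o h)) :=
  ahom_of restrict_linear restrict_act.
Lemma fcoord_restrictE x i : fcoord (restrict x) i = fcoord x (h i).
Proof. exact: fcoord_restrict. Qed.
Lemma restrict_eq0 x i : restrict x = 0 -> fcoord x (h i) = 0.
Proof. by move=> E; rewrite -fcoord_restrictE E; exact: fcoord0. Qed.
End Restrict.

Lemma restrict_aiso (I J : finType) (nu : J -> nat) (h : I -> J) : bijective h ->
  aiso (Fmod k nu : amodType k) (Fmod k (nu \o h)).
Proof.
move=> [g hK gK]; exists (restrict nu h); apply: ahom_bij => [x E|y].
  apply: fcoordP => j; rewrite fcoord0 -(gK j); exact: restrict_eq0 E.
exists (Fmod_of nu (fun j => fcoord y (g j))); apply: fcoordP => i.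
by rewrite fcoord_restrictE fcoord_of hK -[RHS]fcoord_id.
Qed.

Lemma Fmod_sum_aiso (I J : finType) (nu : I + J -> nat) :
  aiso (Fmod k nu : amodType k) (Fmod k (nu \o inl) * Fmod k (nu \o inr))%type.
Proof.
exists (ahom_pair (restrict nu inl) (restrict nu inr)).
apply: ahom_bij => [x E|[y z]].
  by apply: fcoordP => -[i|j]; rewrite fcoord0;
    [exact: (restrict_eq0 i (congr1 fst E))|exact: (restrict_eq0 j (congr1 snd E))].
exists (Fmod_of nu (fun s => match s with inl i => fcoord y i | inr j => fcoord z j end)).
congr pair; apply: fcoordP => i.
  by rewrite fcoord_restrictE fcoord_of -[RHS]fcoord_id.
by rewrite fcoord_restrictE fcoord_of -[RHS]fcoord_id.
Qed.

Lemma aproj_iso (M N : amodType k) : aiso M N -> aprojective M -> aprojective N.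
Proof.
move=> [f /ahom_inv[g [fK gK]]] pM A B p q sur.
have [h hE] := pM A B p (ahom_comp q f) sur.
by exists (ahom_comp h g) => x; rewrite [LHS]hE /= gK.
Qed.

Lemma afingen_iso (M N : amodType k) : aiso M N -> afingen M -> afingen N.
Proof.
move=> [f /ahom_inv[g [fK gK]]] [s Hs].
apply: (@afingen_fin _ _ 'I_(size s) (fun i => f s`_i)) => y.
have [a E] := Hs (g y); exists a; rewrite -[LHS]gK E ahom_sum.
by apply: eq_bigr => i _; rewrite ahom_act.
Qed.

Lemma sum_fgproj (P Q : fgproj k) :
  exists (I : finType) (nu : I -> nat), aiso (Fmod k nu : amodType k) (P * Q)%type.
Proof.
have [r [nu H]] := fgproj_free P; have [s [mu K]] := fgproj_free Q.
pose f (i : 'I_r + 'I_s) := match i with inl i => nu i | inr j => mu j end.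
by exists ('I_r + 'I_s)%type, f; apply: aiso_trans (Fmod_sum_aiso f) (aiso_prod H K).
Qed.

Lemma prod_proj (P Q : fgproj k) : aprojective (P * Q)%type.
Proof. by have [I [nu H]] := sum_fgproj P Q; apply: aproj_iso H (@Fmod_proj _ _ _). Qed.
Lemma prod_fingen (P Q : fgproj k) : afingen (P * Q)%type.
Proof. by have [I [nu H]] := sum_fgproj P Q; apply: afingen_iso H (@Fmod_fingen _ _ _). Qed.
Definition prod_fg (P Q : fgproj k) : fgproj k := FGProj (@prod_proj P Q) (@prod_fingen P Q).

Definition zero_fg : fgproj k := Ffg k (fun _ : 'I_0 => 0%N).
Lemma zero_fgE (x : zero_fg) : x = 0.
Proof. by apply: fcoordP => -[]. Qed.

Lemma Ffg_recl r (nu : 'I_r.+1 -> nat) :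
  aiso (Ffg k nu) (Pfg k (nu ord0) * Ffg k (nu \o lift ord0))%type.
Proof.
pose h (s : unit + 'I_r) := match s with inl _ => ord0 | inr i => lift ord0 i end.
have bh : bijective h.
  exists (fun i => if unlift ord0 i is Some j then inr j else inl tt) => [[[]|i]|i] /=.
  - by rewrite unlift_none.
  - by rewrite liftK.
  - by case: unliftP => [j ->|->].
apply: aiso_trans (restrict_aiso nu bh) _.
apply: aiso_trans (Fmod_sum_aiso _) _; apply: aiso_prod; last exact: aiso_refl.
by exists (@single unit ((nu \o h) \o inl) tt); apply: single_bij => -[].
Qed.

(** Used to extend identities known on the $P_n$ to all finitely generated projectives, for additive
    functors and for additive maps on $K_0$. *)
Lemma fgproj_ind (C : fgproj k -> Prop) :
  (forall P Q : fgproj k, aiso P Q -> C P -> C Q) -> C zero_fg ->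
  (forall n Q, C Q -> C (prod_fg (Pfg k n) Q)) -> forall P, C P.
Proof.
move=> Ci C0 CS P; have [r [nu H]] := fgproj_free P.
apply: (Ci (Ffg k nu)) => //; elim: r nu {H} => [|r IH] nu.
  apply: (Ci zero_fg) => //; exists (ahom0 _ _).
  apply: ahom_bij => [x _|y]; first exact: zero_fgE.
  by exists 0; apply: fcoordP => -[].
by apply: Ci (CS (nu ord0) _ (IH (nu \o lift ord0))); apply: aiso_sym; exact: Ffg_recl.
Qed.

(** The decomposition is picked by choice; by [rkE] the polynomial built from it depends only on the
    module. *)
Definition free_rank (P : fgproj k) : nat := projT1 (cid (fgproj_free P)).
Definition free_nu (P : fgproj k) : 'I_(free_rank P) -> nat :=
  projT1 (cid (projT2 (cid (fgproj_free P)))).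
Lemma free_aiso (P : fgproj k) : aiso (Fmod k (@free_nu P) : amodType k) P.
Proof. by rewrite /free_nu; case: (cid (projT2 (cid (fgproj_free P)))). Qed.

Definition rk (P : fgproj k) : {poly int} := \sum_i 'X^(@free_nu P i).

Lemma coef_sum_Xn (I : finType) (nu : I -> nat) n :
  (\sum_i 'X^(nu i) : {poly int})`_n = #|[pred i | nu i == n]|%:R.
Proof.
rewrite coef_sum -sum1_card natr_sum [RHS]big_mkcond; apply: eq_bigr => i _.
by rewrite coefXn eq_sym inE; case: eqP.
Qed.

Lemma rkE (I : finType) (nu : I -> nat) (P : fgproj k) :
  aiso (Fmod k nu : amodType k) P -> rk P = \sum_i 'X^(nu i).
Proof.
move=> H; apply/polyP => n; rewrite !coef_sum_Xn; congr _%:R; apply: aiso_card.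
exact: aiso_trans (free_aiso P) (aiso_sym H).
Qed.

Lemma rk_iso (P Q : fgproj k) : aiso P Q -> rk P = rk Q.
Proof. by move=> H; rewrite (@rkE _ (@free_nu Q) P) //; apply: aiso_trans (free_aiso Q) (aiso_sym H). Qed.

Lemma rk_sum (P Q R : fgproj k) : aiso R (P * Q)%type -> rk R = rk P + rk Q.
Proof.
move=> H; pose f i := match i with inl i => @free_nu P i | inr j => @free_nu Q j end.
rewrite (@rkE _ f R) ?big_sumType //.
apply: aiso_trans (Fmod_sum_aiso f) _; apply: aiso_trans (aiso_sym H).
exact: aiso_prod (free_aiso P) (free_aiso Q).
Qed.

Lemma rk_prod (P Q : fgproj k) : rk (prod_fg P Q) = rk P + rk Q.
Proof. exact/rk_sum/aiso_refl. Qed.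

Lemma rk_Pn n : rk (Pfg k n) = 'X^n.
Proof.
rewrite (@rkE 'I_1 (fun=> n)); first by rewrite big_ord1.
by exists (@single 'I_1 (fun=> n) ord0); apply: single_bij; exact: ord1.
Qed.

Lemma rk0 (P : fgproj k) : (forall x : P, x = 0) -> rk P = 0.
Proof.
move=> H; rewrite (@rkE 'I_0 (fun=> 0%N)) ?big_ord0 //; exists (ahom0 _ _).
apply: ahom_bij => [x _|y]; first exact: zero_fgE.
by exists 0; rewrite (H y).
Qed.
End FreeIsos.

(** * The Grothendieck group *)

Section K0Rank.
Context (k : fieldType).
Implicit Types (x y : K0 k) (P Q R : fgproj k).

Lemma K0_ind (C : K0 k -> Prop) : (forall e, C (K0_class e)) -> forall x, C x.
Proof. by move=> H x; rewrite -[x]K0_reprK. Qed.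

Lemma K0_addA : associative (@K0_add k).
Proof.
move=> x y z; elim/K0_ind: x => e; elim/K0_ind: y => f; elim/K0_ind: z => g.
rewrite !K0_add_class; exact/K0_classP/K0_addeA.
Qed.
Lemma K0_addC : commutative (@K0_add k).
Proof.
move=> x y; elim/K0_ind: x => e; elim/K0_ind: y => f.
rewrite !K0_add_class; exact/K0_classP/K0_addeC.
Qed.
Lemma K0_add0 : left_id K0_zero (@K0_add k).
Proof.
move=> x; elim/K0_ind: x => e; rewrite /K0_zero !K0_add_class; exact/K0_classP/K0_add0e.
Qed.
Lemma K0_addN : left_inverse K0_zero (@K0_opp k) (@K0_add k).
Proof.
move=> x; elim/K0_ind: x => e; rewrite K0_opp_class !K0_add_class.
exact/K0_classP/K0_addNe.
Qed.

(** Makes the lemmas on big operators available for sums of classes, although $K_0$ carries no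
    zmodType structure. *)
HB.instance Definition _ :=
  Monoid.isComLaw.Build (K0 k) K0_zero (@K0_add k) K0_addA K0_addC K0_add0.

Lemma K0_addACA : interchange (@K0_add k) (@K0_add k).
Proof. exact: Monoid.mulmACA. Qed.

Lemma K0_addIr x y z : K0_add x z = K0_add y z -> x = y.
Proof.
move=> E; rewrite -[x]K0_add0 -[y]K0_add0 -(K0_addN z) ![K0_add (K0_opp z) z]K0_addC.
by rewrite ![K0_add (K0_add _ _) _]K0_addC !K0_addA E.
Qed.

Lemma K0_cls_sum P Q R : aiso R (P * Q)%type -> K0_cls R = K0_add (K0_cls P) (K0_cls Q).
Proof. by move=> H; rewrite K0_add_class; exact/K0_classP/K0_rel. Qed.

(** A zero module satisfies $P\cong P\oplus P$, hence $[P]=[P]+[P]$. *)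
Lemma K0_cls0 P : (forall x : P, x = 0) -> K0_cls P = K0_zero.
Proof.
move=> H; have E : aiso P (P * P)%type.
  exists (ahom0 _ _); apply: ahom_bij => [x _|[y z]]; first exact: H.
  by exists 0; rewrite (H y) (H z).
apply: (@K0_addIr _ _ (K0_cls P)); rewrite K0_add0; exact/esym/K0_cls_sum.
Qed.

(** The defining relations only speak of direct sums; isomorphism invariance follows from $P\cong
    Q\oplus 0$. *)
Lemma K0_cls_iso P Q : aiso P Q -> K0_cls P = K0_cls Q.
Proof.
move=> H; rewrite (@K0_cls_sum Q (zero_fg k)).
  by rewrite (K0_cls0 (@zero_fgE k)) K0_addC K0_add0.
apply: aiso_trans H _; exists (ahom_inl _ _); exists fst => // -[x y] /=.
by rewrite /pair_fun /= [y]zero_fgE.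
Qed.

Lemma K0_free P : K0_cls P = \big[@K0_add k/K0_zero]_(i < free_rank P) K0_cls (Pfg k (free_nu i)).
Proof.
rewrite -(@K0_cls_iso (Ffg k (@free_nu _ P)) P); last exact: free_aiso.
elim: (free_rank P) (@free_nu _ P) => [|r IH] nu.
  by rewrite big_ord0; apply: K0_cls0 => x; apply: fcoordP => -[].
rewrite big_ord_recl -(IH (nu \o lift ord0)); apply: K0_cls_sum.
exact: Ffg_recl.
Qed.

(** The coefficients count the summands $P_n$, so equal ranks mean that the two lists of summands
    are permutations of each other. *)
Lemma rk_inj P Q : rk P = rk Q -> K0_cls P = K0_cls Q.
Proof.
move=> E; have H P' : K0_cls P' =
    \big[@K0_add k/K0_zero]_(n <- codom (@free_nu _ P')) K0_cls (Pfg k n).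
  by rewrite K0_free /codom /image_mem big_map big_enum.
rewrite !H; apply: perm_big; rewrite /perm_eq; apply/allP => n _ /=; apply/eqP.
have C P' : count_mem n (codom (@free_nu _ P')) = #|[pred i | @free_nu _ P' i == n]|.
  rewrite /codom /image_mem count_map -sum1_count big_enum_cond -sum1_card.
  by apply: eq_bigl => i; rewrite !inE.
move/polyP/(_ n): E; rewrite /rk !coef_sum_Xn -!C => /eqP.
by rewrite Num.Theory.eqr_nat => /eqP.
Qed.

Fixpoint rk_expr (e : K0_expr k) : {poly int} :=
  match e with
  | K0_gen P => rk P
  | K0_zeroe => 0
  | K0_adde e f => rk_expr e + rk_expr f
  | K0_oppe e => - rk_expr e
  end.

Lemma rk_expr_eq e f : K0_eq e f -> rk_expr e = rk_expr f.
Proof.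
elim=> //=.
- by move=> ? ? ? _ -> _ ->.
- by move=> ? ? ? ? _ -> _ ->.
- by move=> ? ? _ ->.
- by move=> ? ? ?; rewrite addrA.
- by move=> ? ?; rewrite addrC.
- by move=> ?; rewrite add0r.
- by move=> ?; rewrite addNr.
- by move=> P P' P''; exact: rk_sum.
Qed.

Definition K0_rk x : {poly int} := rk_expr (K0_repr x).

Lemma K0_rk_class e : K0_rk (K0_class e) = rk_expr e.
Proof. by apply: rk_expr_eq; apply/K0_classP; rewrite K0_reprK. Qed.
Lemma K0_rk_cls P : K0_rk (K0_cls P) = rk P.
Proof. exact: K0_rk_class. Qed.
Lemma K0_rkD : {morph K0_rk : x y / K0_add x y >-> x + y}.
Proof.
move=> x y; elim/K0_ind: x => e; elim/K0_ind: y => f.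
by rewrite K0_add_class !K0_rk_class.
Qed.
Lemma K0_rkN : {morph K0_rk : x / K0_opp x >-> - x}.
Proof. by move=> x; elim/K0_ind: x => e; rewrite K0_opp_class !K0_rk_class. Qed.
Lemma K0_rk0 : K0_rk K0_zero = 0.
Proof. exact: K0_rk_class. Qed.

(** Direct sums absorb addition, and negation exchanges the two modules. *)
Lemma K0_diff x : exists P Q, K0_add x (K0_cls Q) = K0_cls P.
Proof.
elim/K0_ind: x; elim=> [P||e [P [Q E]] f [P' [Q' E']]|e [P [Q E]]].
- by exists P, (zero_fg k); rewrite (K0_cls0 (@zero_fgE k)) K0_addC K0_add0.
- by exists (zero_fg k), (zero_fg k); rewrite -/(K0_zero) K0_add0.
- exists (prod_fg P P'), (prod_fg Q Q').
  rewrite -K0_add_class !(@K0_cls_sum _ _ (prod_fg _ _) (aiso_refl _)) -E -E'.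
  by rewrite [LHS]K0_addACA.
- by exists Q, P; rewrite -K0_opp_class -E K0_addA K0_addN K0_add0.
Qed.

(** Writing the two elements as $[P]-[Q]$ and $[P']-[Q']$, equal ranks say that $P\oplus Q'$ and
    $P'\oplus Q$ have the same rank, hence the same class. *)
Lemma K0_rk_inj : injective K0_rk.
Proof.
move=> x y E; have [P [Q EP]] := K0_diff x; have [P' [Q' EP']] := K0_diff y.
apply: (@K0_addIr _ _ (K0_add (K0_cls Q) (K0_cls Q'))).
rewrite K0_addA EP [K0_add (K0_cls Q) _]K0_addC K0_addA EP'.
rewrite -!(@K0_cls_sum _ _ (prod_fg _ _) (aiso_refl _)); apply: rk_inj.
rewrite !rk_prod -!K0_rk_cls -EP -EP' !K0_rkD E.
by rewrite -!addrA [K0_rk (K0_cls Q) + _]addrC.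
Qed.

(** The image is a subgroup of $\mathbb{Z}[x]$ containing every $x^n$. *)
Lemma K0_rk_surj p : exists x, K0_rk x = p.
Proof.
pose S (p : {poly int}) := exists x, K0_rk x = p.
have SD q r : S q -> S r -> S (q + r).
  by move=> [x <-] [y <-]; exists (K0_add x y); rewrite K0_rkD.
have SN q : S q -> S (- q) by move=> [x <-]; exists (K0_opp x); rewrite K0_rkN.
have S0 : S 0 by exists K0_zero; exact: K0_rk0.
have SX n : S 'X^n by exists (K0_cls (Pfg k n)); rewrite K0_rk_cls rk_Pn.
have SM q n : S q -> S (q *+ n) by move=> H; elim: n => [//|n IH]; rewrite mulrS; exact: SD.
rewrite -[p]coefK poly_def; apply: (big_ind S) => // i _.
have -> : p`_i *: 'X^i = 'X^i *~ p`_i :> {poly int}.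
  by rewrite -[in LHS](intz p`_i) scaler_int.
case: (p`_i) => n; first exact: SM.
by apply: SN; exact: SM.
Qed.

Lemma K0_rk_bij : bijective K0_rk.
Proof.
pose g p := projT1 (cid (K0_rk_surj p)).
have gK : cancel g K0_rk by move=> p; rewrite /g; case: cid.
by exists g => // x; apply: K0_rk_inj; rewrite gK.
Qed.

Lemma K0_rk_uniq (psi : K0 k -> {poly int}) :
  {morph psi : x y / K0_add x y >-> x + y} ->
  (forall n, psi (K0_cls (Pfg k n)) = 'X^n) -> psi =1 K0_rk.
Proof.
move=> D X x; have psi0 : psi K0_zero = 0.
  by apply: (addrI (psi K0_zero)); rewrite -D K0_add0 addr0.
have H P : psi (K0_cls P) = rk P.
  elim/fgproj_ind: P => [P Q i E||n Q IH].
  - by rewrite -(K0_cls_iso i) -(rk_iso i).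
  - by rewrite (K0_cls0 (@zero_fgE k)) psi0 rk0 //; exact: zero_fgE.
  - by rewrite (@K0_cls_sum _ _ (prod_fg _ _) (aiso_refl _)) D X IH rk_prod rk_Pn.
have [P [Q E]] := K0_diff x.
by apply: (addIr (psi (K0_cls Q))); rewrite -D E !H -!K0_rk_cls -K0_rkD E.
Qed.

End K0Rank.

(** * Multiplicativity of the rank *)

Section Additive.
Context (k : fieldType).

(** What remains of a tensor product when one argument is fixed; the rank is computed in one
    variable at a time. *)
Record addfunctor := AddFunctor {
  af_obj :> fgproj k -> fgproj k;
  af_hom : forall P Q : fgproj k, ahom P Q -> ahom (af_obj P) (af_obj Q);
  af_id : forall P : fgproj k, af_hom (ahom_id P) =1 ahom_id (af_obj P);
  af_comp : forall (P Q R : fgproj k) (g : ahom Q R) (f : ahom P Q),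
    af_hom (ahom_comp g f) =1 ahom_comp (af_hom g) (af_hom f);
  af_lin : forall (P Q : fgproj k) c (f g : ahom P Q),
    af_hom (ahom_lincomb c f g) =1 ahom_lincomb c (af_hom f) (af_hom g) }.

Arguments af_id : clear implicits.
Arguments af_comp : clear implicits.
Arguments af_lin : clear implicits.

Context (F : addfunctor).
Implicit Types P Q R : fgproj k.

Lemma af_ext P Q (f g : ahom P Q) : f =1 g -> af_hom F f =1 af_hom F g.
Proof. by move=> /ahom_ext ->. Qed.

Lemma af_iso P Q : aiso P Q -> aiso (F P) (F Q).
Proof.
move=> [f /ahom_inv[g [fK gK]]]; exists (af_hom F f), (af_hom F g) => x.
  by rewrite -[LHS](af_comp F _ _ _ g f) (@af_ext _ _ _ (ahom_id P)) ?af_id.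
by rewrite -[LHS](af_comp F _ _ _ f g) (@af_ext _ _ _ (ahom_id Q)) ?af_id.
Qed.

(** Linearity is only available in the form $cf+g$, and zero is the combination $-0+0$. *)
Lemma af_hom0 P Q x : af_hom F (ahom0 P Q) x = 0.
Proof.
have := af_lin F _ _ (-1) (ahom0 P Q) (ahom0 P Q) x.
rewrite (@af_ext _ _ _ (ahom0 P Q)) => [|y] /=; last by rewrite scaleN1r addNr.
by rewrite scaleN1r addNr.
Qed.

Lemma af_zero P : (forall x : P, x = 0) -> forall x : F P, x = 0.
Proof.
move=> H x; rewrite -[x](af_id F P x) -(@af_hom0 P P x); apply: af_ext => y.
exact: H.
Qed.

(** A direct sum is characterised by the equations $p_ai_b=\delta_{ab}$ and $i_1p_1+i_2p_2=1$, which
    an additive functor preserves. *)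
Lemma af_prod P Q : aiso (F (prod_fg P Q)) (F P * F Q)%type.
Proof.
pose p1 : ahom (prod_fg P Q) P := ahom_fst P Q.
pose p2 : ahom (prod_fg P Q) Q := ahom_snd P Q.
pose i1 : ahom P (prod_fg P Q) := ahom_inl P Q.
pose i2 : ahom Q (prod_fg P Q) := ahom_inr P Q.
exists (ahom_pair (af_hom F p1) (af_hom F p2)).
exists (ahom_copair (af_hom F i1) (af_hom F i2)) => [x|[y z]].
  rewrite ahom_copairE -[X in X + _](af_comp F _ _ _ i1 p1) -[X in _ + X](af_comp F _ _ _ i2 p2).
  have := af_lin F _ _ 1 (ahom_comp i1 p1) (ahom_comp i2 p2) x.
  rewrite [X in _ = X]ahom_addE => <-; rewrite (@af_ext _ _ _ (ahom_id _)) ?af_id //.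
  by move=> [a b]; rewrite [LHS]ahom_addE; congr pair; rewrite /= ?addr0 ?add0r.
rewrite ahom_copairE; congr pair; rewrite /= ahomD.
  rewrite -[X in X + _](af_comp F _ _ _ p1 i1) -[X in _ + X](af_comp F _ _ _ p1 i2).
  rewrite (@af_ext _ _ _ (ahom_id P)) // af_id.
  by rewrite (@af_ext _ _ _ (ahom0 Q P)) // af_hom0 addr0.
rewrite -[X in X + _](af_comp F _ _ _ p2 i1) -[X in _ + X](af_comp F _ _ _ p2 i2).
rewrite (@af_ext _ _ _ (ahom0 P Q)) // af_hom0 add0r.
by rewrite (@af_ext _ _ _ (ahom_id Q)) // af_id.
Qed.

Lemma rk_af q : (forall n, rk (F (Pfg k n)) = 'X^n * q) -> forall P, rk (F P) = rk P * q.
Proof.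
move=> H; elim/fgproj_ind => [P Q i E||n Q IH].
- by rewrite -(rk_iso (af_iso i)) E (rk_iso i).
- by rewrite !rk0 ?mul0r //; [exact: zero_fgE|apply: af_zero; exact: zero_fgE].
- by rewrite (rk_sum (af_prod _ _)) rk_prod H IH rk_Pn mulrDl.
Qed.
End Additive.

Section TensorRank.
Context (k : fieldType) (T : tensor_product k).
Implicit Types P Q R : fgproj k.

Lemma tens_left_comp R (P Q S : fgproj k) (g : ahom Q S) (f : ahom P Q) :
  tens_hom T (ahom_comp g f) (ahom_id R)
  =1 ahom_comp (tens_hom T g (ahom_id R)) (tens_hom T f (ahom_id R)).
Proof. by move=> x; rewrite -tens_comp; congr (tens_hom T _ _ x); exact: ahom_ext. Qed.
Lemma tens_right_comp R (P Q S : fgproj k) (g : ahom Q S) (f : ahom P Q) :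
  tens_hom T (ahom_id R) (ahom_comp g f)
  =1 ahom_comp (tens_hom T (ahom_id R) g) (tens_hom T (ahom_id R) f).
Proof. by move=> x; rewrite -tens_comp; congr (tens_hom T _ _ x); exact: ahom_ext. Qed.

Definition tens_left R : addfunctor k :=
  @AddFunctor k (fun P => T P R) (fun P Q f => tens_hom T f (ahom_id R))
    (fun P => @tens_id k T P R) (@tens_left_comp R)
    (fun P Q c f g => @tens_linl k T P Q R R c f g (ahom_id R)).
Definition tens_right R : addfunctor k :=
  @AddFunctor k (fun P => T R P) (fun P Q f => tens_hom T (ahom_id R) f)
    (fun P => @tens_id k T R P) (@tens_right_comp R)
    (fun P Q c f g => @tens_linr k T R R P Q c (ahom_id R) f g).

Lemma rk_tens P Q : rk (T P Q) = rk P * rk Q.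
Proof.
apply: (@rk_af k (tens_left Q)) => n.
(* The values on $P_n$ with [Q] fixed come from the other variable, with $P_n$ fixed. *)
rewrite mulrC; apply: (@rk_af k (tens_right (Pfg k n))) => m.
rewrite /= -exprD addnC -(rk_Pn k (n + m)); apply: rk_iso.
by exists (tens_Pn T n m); exact: tens_Pn_bij.
Qed.
End TensorRank.

(** * Stacking of diagrams, extended bilinearly *)

Section TensorAlgebra.
Context (k : fieldType).
Implicit Types a b : Aminus k.

Definition tensA a b : Aminus k := lext (fun y => lext (fun z => basis k (dtens y z)) b) a.

Lemma tensA_linl c a a' b : tensA (c *: a + a') b = c *: tensA a b + tensA a' b.
Proof. exact: lextP. Qed.
Lemma tensA_linr c a b b' : tensA a (c *: b + b') = c *: tensA a b + tensA a b'.
Proof.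
rewrite /tensA /lext !scaler_sumr -big_split /=; apply: eq_bigr => y _.
by rewrite -/(lext _ _) lextP scalerDr !scalerA mulrC.
Qed.
Lemma tensA_basis y z : tensA (basis k y) (basis k z) = basis k (dtens y z).
Proof. by rewrite /tensA !lext_basis. Qed.
Lemma tens0A b : tensA 0 b = 0.
Proof. exact: linear0. Qed.
Lemma tensA0 a : tensA a 0 = 0.
Proof. by have := tensA_linr (-1) a 0 0; rewrite scaler0 addr0 scaleN1r addNr. Qed.
Lemma tensA_suml (I : Type) (r : seq I) P (F : I -> Aminus k) b :
  tensA (\sum_(i <- r | P i) F i) b = \sum_(i <- r | P i) tensA (F i) b.
Proof.
apply: (big_morph (fun a => tensA a b)) => [x y|]; last exact: tens0A.
by have := tensA_linl 1 x y b; rewrite !scale1r.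
Qed.
Lemma tensA_sumr (I : Type) (r : seq I) P (F : I -> Aminus k) a :
  tensA a (\sum_(i <- r | P i) F i) = \sum_(i <- r | P i) tensA a (F i).
Proof.
apply: (big_morph (tensA a)) => [x y|]; last exact: tensA0.
by have := tensA_linr 1 a x y; rewrite !scale1r.
Qed.

Lemma dtens_did n m : dtens (did n) (did m) = did (n + m).
Proof.
apply: diagram_eq => //; apply/fsetP => -[i j]; rewrite [RHS]larcs_idP.
apply/larcs_tensP/andP => [[|[i' [j' []]]]|[/eqP<- lt]].
- by rewrite larcs_idP => /andP[-> lt]; rewrite ltn_addl.
- rewrite larcs_idP => /andP[/eqP<- lt] -> ->.
  by rewrite eqxx addnC ltn_add2r.
case: (ltnP i m) => [lm|le]; first by left; rewrite larcs_idP eqxx.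
right; exists (i - m)%N, (i - m)%N; rewrite larcs_idP eqxx /= subnKC //; split=> //.
by rewrite ltn_subLR // addnC.
Qed.

Lemma tensA_id n m : tensA (idA k n) (idA k m) = idA k (n + m).
Proof. by rewrite tensA_basis dtens_did. Qed.

(** This and the next three lemmas express that no larc of a stack joins the two layers. *)
Lemma larcs_tens_low (y z : diagram) i j :
  (i < dleft z)%N -> ((i, j) \in larcs (dtens y z)) = ((i, j) \in larcs z).
Proof.
move=> lt; apply/larcs_tensP/idP => [[//|[i' [j' [_ E _]]]]|]; last by left.
by rewrite E ltnNge leq_addr in lt.
Qed.
Lemma larcs_tens_lowr (y z : diagram) i j :
  (j < dright z)%N -> ((i, j) \in larcs (dtens y z)) = ((i, j) \in larcs z).
Proof.
move=> lt; apply/larcs_tensP/idP => [[//|[i' [j' [_ _ E]]]]|]; last by left.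
by rewrite E ltnNge leq_addr in lt.
Qed.
Lemma larcs_tens_high (y z : diagram) i j :
  ((dleft z + i, j)%N \in larcs (dtens y z)) =
  (dright z <= j)%N && ((i, j - dright z)%N \in larcs y).
Proof.
apply/larcs_tensP/andP => [[/larcs_bound/andP[]|[i' [j' [h /addnI E ->]]]]|[le h]].
- by rewrite ltnNge leq_addr.
- by rewrite E leq_addr addKn.
- by right; exists i, (j - dright z)%N; rewrite subnKC.
Qed.
Lemma larcs_tens_highr (y z : diagram) i j :
  ((i, dright z + j)%N \in larcs (dtens y z)) =
  (dleft z <= i)%N && ((i - dleft z, j)%N \in larcs y).
Proof.
apply/larcs_tensP/andP => [[/larcs_bound/andP[_]|[i' [j' [h -> /addnI E]]]]|[le h]].
- by rewrite ltnNge leq_addr.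
- by rewrite E leq_addr addKn.
- by right; exists (i - dleft z)%N, j; rewrite subnKC.
Qed.

(** The middle points split at the same height on both sides, so a floating arc lies within one
    layer. *)
Lemma composable_dtens (y z y' z' : diagram) :
  dright y = dleft y' -> dright z = dleft z' ->
  composable (dtens y z) (dtens y' z') = composable y y' && composable z z'.
Proof.
move=> Ey Ez; apply/composableP/andP => [[_ H]|].
  split; apply/composableP; split=> // j lt.
    have lt' : (dright z + j < dright (dtens y z))%N by rewrite addnC ltn_add2r.
    case: (H _ lt') => [[i]|[l]].
      by rewrite larcs_tens_highr => /andP[_ h]; left; exists (i - dleft z)%N.
    by rewrite Ez larcs_tens_high => /andP[_ h]; right; exists (l - dright z')%N.
  have lt' : (j < dright (dtens y z))%N by rewrite ltn_addl.
  case: (H _ lt') => [[i]|[l]].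
    by rewrite larcs_tens_lowr // => h; left; exists i.
  by rewrite larcs_tens_low -?Ez // => h; right; exists l.
move=> [/composableP[_ H] /composableP[_ K]]; split; first by congr addn.
move=> j lt; case: (ltnP j (dright z)) => [lj|le].
  case: (K _ lj) => [[i h]|[l h]]; [left; exists i|right; exists l].
    by rewrite larcs_tens_lowr.
  by rewrite larcs_tens_low -?Ez.
have lt' : (j - dright z < dright y)%N by rewrite ltn_subLR // addnC.
rewrite -(subnKC le); case: (H _ lt') => [[i h]|[l h]].
  by left; exists (dleft z + i)%N; rewrite larcs_tens_highr leq_addr addKn.
by right; exists (dright z' + l)%N; rewrite Ez larcs_tens_high leq_addr addKn -Ez.
Qed.

Lemma dcat_dtens (y z y' z' : diagram) : dright y = dleft y' -> dright z = dleft z' ->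
  dcat (dtens y z) (dtens y' z') = dtens (dcat y y') (dcat z z').
Proof.
move=> Ey Ez; apply: diagram_eq => //; apply/fsetP => -[i l].
apply/larcs_catP/larcs_tensP.
  move=> [j [/larcs_tensP[h|[i' [j' [h -> ->]]]] h']].
    left; apply/larcs_catP; exists j; split=> //; rewrite larcs_tens_low // in h'.
    by have /andP[_ lt] := larcs_bound h; rewrite -Ez.
  right; rewrite Ez larcs_tens_high in h'; case/andP: h' => le h'.
  exists i', (l - dright z')%N; rewrite subnKC //; split=> //.
  by apply/larcs_catP; exists j'.
move=> [/larcs_catP[j [h h']]|[i' [l' [/larcs_catP[j [h h']] -> ->]]]].
  by exists j; split; apply/larcs_tensP; left.
exists (dright z + j)%N; split; apply/larcs_tensP; right; first by exists i', j.
by exists j, l'; rewrite Ez.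
Qed.

Lemma Aminus_lin_ext (f g : Aminus k -> Aminus k) :
  (forall c a b, f (c *: a + b) = c *: f a + f b) ->
  (forall c a b, g (c *: a + b) = c *: g a + g b) ->
  (forall d, f (basis k d) = g (basis k d)) -> f =1 g.
Proof.
move=> fL gL E; elim/Aminus_ind => [|//|c a b Ha Hb]; last by rewrite fL gL Ha Hb.
have Z h : (forall c a b, h (c *: a + b) = c *: h a + h b) -> h (0 : Aminus k) = 0 :> Aminus k.
  by move=> hL; have := hL (-1) 0 0; rewrite scaler0 addr0 scaleN1r addNr.
by rewrite !Z.
Qed.

(** The idempotents are written out so that all four diagrams are arbitrary; the identity then
    extends by linearity in one argument at a time. *)
Lemma tensA_mul_basis n m y z y' z' :
  mulA (tensA (mulA (basis k y) (idA k n)) (mulA (basis k z) (idA k m)))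
       (tensA (mulA (idA k n) (basis k y')) (mulA (idA k m) (basis k z'))) =
  tensA (mulA (mulA (basis k y) (idA k n)) (mulA (idA k n) (basis k y')))
        (mulA (mulA (basis k z) (idA k m)) (mulA (idA k m) (basis k z'))).
Proof.
rewrite !basis_id !id_basis.
case: (dright y =P n) => [Ey|_]; last by rewrite !(tens0A, mul0A).
case: (dright z =P m) => [Ez|_]; last by rewrite !(tensA0, mul0A, tens0A).
case: (dleft y' =P n) => [Ey'|_]; last by rewrite !(tens0A, mulA0).
case: (dleft z' =P m) => [Ez'|_]; last by rewrite !(tensA0, mulA0).
rewrite !tensA_basis !mulA_basis /dmul composable_dtens ?Ey ?Ez //.
case: (composable y y'); case: (composable z z') => /=; rewrite ?tens0A ?tensA0 //.
by rewrite tensA_basis dcat_dtens ?Ey ?Ez.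
Qed.

(** The interchange law. The homogeneity assumptions matter: stacks of sizes $(n,m)$ and $(n',m')$
    with $n+m=n'+m'$ but $n\neq n'$ may compose to something nonzero, while the right-hand side
    vanishes. *)
Lemma tensA_mul n m a b a' b' :
  mulA a (idA k n) = a -> mulA b (idA k m) = b ->
  mulA (idA k n) a' = a' -> mulA (idA k m) b' = b' ->
  mulA (tensA a b) (tensA a' b') = tensA (mulA a a') (mulA b b').
Proof.
move=> <- <- <- <-; move: a.
apply: Aminus_lin_ext => [c a a2|c a a2|y].
1,2: by rewrite ?(mulA_linl, tensA_linl).
move: (mulA (basis k y) (idA k n)) (tensA_mul_basis n m y) => x H; move: b.
apply: Aminus_lin_ext => [c b b2|c b b2|z].
- by rewrite mulA_linl tensA_linr mulA_linl.
- by rewrite !mulA_linl tensA_linr.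
move: (mulA (basis k z) (idA k m)) (H z) => {}y {}H; move: a'.
apply: Aminus_lin_ext => [c a a2|c a a2|z'].
- by rewrite mulA_linr tensA_linl mulA_linr.
- by rewrite !mulA_linr tensA_linl.
move: (mulA (idA k n) (basis k z')) (H z') => {}z {}H; move: b'.
apply: Aminus_lin_ext => [c b b2|c b b2|z''].
- by rewrite mulA_linr tensA_linr mulA_linr.
- by rewrite !mulA_linr tensA_linr.
exact: H.
Qed.

End TensorAlgebra.

(** * Existence of the tensor product *)

Section TensorExists.
Context (k : fieldType).

Section Entries.
Context (I J : finType) (nu : I -> nat) (mu : J -> nat).
(** Homomorphisms of left modules are right multiplications by matrices over $A^-$, whence the order
    of the factors in [entry_comp]. *)
Definition entry (f : ahom (Fmod k nu : amodType k) (Fmod k mu)) i j := fcoord (f (fone k nu i)) j.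

Lemma entry_l f i j : mulA (idA k (nu i)) (entry f i j) = entry f i j.
Proof. by rewrite /entry -fcoord_actE -ahom_act fone_id. Qed.
Lemma entry_r f i j : mulA (entry f i j) (idA k (mu j)) = entry f i j.
Proof. exact: fcoord_id. Qed.

Lemma entry_ext (f g : ahom (Fmod k nu : amodType k) (Fmod k mu)) :
  (forall i j, entry f i j = entry g i j) -> f = g.
Proof.
move=> E; apply: ahom_ext; apply: ahom_Fmod_ext => i; apply: fcoordP => j; exact: E.
Qed.

Lemma entry_lincomb c f g i j : entry (ahom_lincomb c f g) i j = c *: entry f i j + entry g i j.
Proof. exact: fcoordL. Qed.
End Entries.

Lemma entry_comp (I J L : finType) (nu : I -> nat) (mu : J -> nat) (la : L -> nat)
    (g : ahom (Fmod k mu : amodType k) (Fmod k la)) (f : ahom (Fmod k nu : amodType k) (Fmod k mu)) i l :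
  entry (ahom_comp g f) i l = \sum_j mulA (entry f i j) (entry g j l).
Proof.
rewrite [LHS](congr1 (fun x : Fmod k la => fcoord x l) (ahom_Fmod g (f (fone k nu i)))) fcoord_sum.
by apply: eq_bigr => j _; rewrite fcoord_actE.
Qed.

Lemma entry_id (I : finType) (nu : I -> nat) i j :
  entry (ahom_id (Fmod k nu : amodType k)) i j = if j == i then idA k (nu i) else 0.
Proof. exact: fcoord_one. Qed.

Lemma tensA_idl n m (a b : Aminus k) : mulA (idA k n) a = a -> mulA (idA k m) b = b ->
  mulA (idA k (n + m)) (tensA a b) = tensA a b.
Proof. by move=> Ha Hb; rewrite -tensA_id (tensA_mul _ _ Ha Hb) ?Ha ?Hb // mulA_id eqxx. Qed.
Lemma tensA_idr n m (a b : Aminus k) : mulA a (idA k n) = a -> mulA b (idA k m) = b ->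
  mulA (tensA a b) (idA k (n + m)) = tensA a b.
Proof. by move=> Ha Hb; rewrite -tensA_id (tensA_mul Ha Hb) ?Ha ?Hb // mulA_id eqxx. Qed.

Definition addnu (I J : finType) (nu : I -> nat) (mu : J -> nat) (ij : I * J) : nat :=
  (nu ij.1 + mu ij.2)%N.

Section Kronecker.
Context (I I' J J' : finType) (nu : I -> nat) (nu' : I' -> nat) (mu : J -> nat) (mu' : J' -> nat).
Implicit Types (f : ahom (Fmod k nu : amodType k) (Fmod k nu'))
  (g : ahom (Fmod k mu : amodType k) (Fmod k mu')).

(** The Kronecker product of two matrices, with stacking in place of multiplication of entries. *)
Definition ftens f g : ahom (Fmod k (addnu nu mu) : amodType k) (Fmod k (addnu nu' mu')) :=
  Fhom (fun ij => Fmod_of (addnu nu' mu')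
    (fun ij' => tensA (entry f ij.1 ij'.1) (entry g ij.2 ij'.2))).

Lemma entry_ftens f g ij ij' :
  entry (ftens f g) ij ij' = tensA (entry f ij.1 ij'.1) (entry g ij.2 ij'.2).
Proof.
rewrite /entry Fhom_one fcoord_actE fcoord_of.
by rewrite tensA_idr ?entry_r // tensA_idl ?entry_l.
Qed.
End Kronecker.

Lemma ftens_id (I J : finType) (nu : I -> nat) (mu : J -> nat) :
  ftens (ahom_id (Fmod k nu : amodType k)) (ahom_id (Fmod k mu : amodType k)) = ahom_id _.
Proof.
apply: entry_ext => -[i j] [i' j']; rewrite entry_ftens !entry_id /= xpair_eqE.
by case: eqP; case: eqP; rewrite /= ?tens0A ?tensA0 ?tensA_id.
Qed.

Lemma ftens_comp (I I' I'' J J' J'' : finType) (nu : I -> nat) (nu' : I' -> nat)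
    (nu'' : I'' -> nat) (mu : J -> nat) (mu' : J' -> nat) (mu'' : J'' -> nat)
    (f : ahom (Fmod k nu : amodType k) (Fmod k nu'))
    (f' : ahom (Fmod k nu' : amodType k) (Fmod k nu''))
    (g : ahom (Fmod k mu : amodType k) (Fmod k mu'))
    (g' : ahom (Fmod k mu' : amodType k) (Fmod k mu'')) :
  ftens (ahom_comp f' f) (ahom_comp g' g) = ahom_comp (ftens f' g') (ftens f g).
Proof.
apply: entry_ext => ij ij''; rewrite entry_ftens !entry_comp.
rewrite tensA_suml; under eq_bigr do rewrite tensA_sumr.
rewrite pair_big; apply: eq_bigr => ij' _; rewrite !entry_ftens.
(* Both entries to the left end, and those to the right begin, at the same middle idempotents, as
   the interchange law demands. *)
by rewrite (tensA_mul (n := nu' ij'.1) (m := mu' ij'.2)) ?entry_l ?entry_r.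
Qed.

Lemma ftens_linl (I I' J J' : finType) (nu : I -> nat) (nu' : I' -> nat) (mu : J -> nat)
    (mu' : J' -> nat) c (f f' : ahom (Fmod k nu : amodType k) (Fmod k nu'))
    (g : ahom (Fmod k mu : amodType k) (Fmod k mu')) :
  ftens (ahom_lincomb c f f') g = ahom_lincomb c (ftens f g) (ftens f' g).
Proof.
by apply: entry_ext => ij ij'; rewrite entry_ftens !entry_lincomb !entry_ftens tensA_linl.
Qed.
Lemma ftens_linr (I I' J J' : finType) (nu : I -> nat) (nu' : I' -> nat) (mu : J -> nat)
    (mu' : J' -> nat) c (f : ahom (Fmod k nu : amodType k) (Fmod k nu'))
    (g g' : ahom (Fmod k mu : amodType k) (Fmod k mu')) :
  ftens f (ahom_lincomb c g g') = ahom_lincomb c (ftens f g) (ftens f g').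
Proof.
by apply: entry_ext => ij ij'; rewrite entry_ftens !entry_lincomb !entry_ftens tensA_linr.
Qed.

Definition free_in (P : fgproj k) : ahom (Fmod k (@free_nu k P) : amodType k) P :=
  projT1 (cid (free_aiso P)).
Lemma free_in_bij P : bijective (free_in P).
Proof. by rewrite /free_in; case: cid. Qed.
Definition free_out (P : fgproj k) : ahom P (Fmod k (@free_nu k P)) :=
  projT1 (cid (ahom_inv (free_in_bij P))).
Lemma free_inK P : cancel (free_in P) (free_out P).
Proof. by rewrite /free_out; case: cid => ? []. Qed.
Lemma free_outK P : cancel (free_out P) (free_in P).
Proof. by rewrite /free_out; case: cid => ? []. Qed.

(** Formed on the chosen free forms; [to_free] conjugates morphisms by the chosen isomorphisms,
    which makes functoriality a statement on matrices. *)
Definition tobj (P Q : fgproj k) : fgproj k := Ffg k (addnu (@free_nu k P) (@free_nu k Q)).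
Definition to_free (P P' : fgproj k) (f : ahom P P') :
    ahom (Fmod k (@free_nu k P) : amodType k) (Fmod k (@free_nu k P')) :=
  ahom_comp (free_out P') (ahom_comp f (free_in P)).
Definition thom (P P' Q Q' : fgproj k) (f : ahom P P') (g : ahom Q Q') :
    ahom (tobj P Q) (tobj P' Q') :=
  ftens (to_free f) (to_free g).

Lemma to_free_id (P : fgproj k) : to_free (ahom_id P) = ahom_id _.
Proof. by apply: ahom_ext => x; exact: free_inK. Qed.
Lemma to_free_comp (P Q R : fgproj k) (g : ahom Q R) (f : ahom P Q) :
  to_free (ahom_comp g f) = ahom_comp (to_free g) (to_free f).
Proof. by apply: ahom_ext => x; rewrite /= free_outK. Qed.
Lemma to_free_lincomb (P Q : fgproj k) c (f g : ahom P Q) :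
  to_free (ahom_lincomb c f g) = ahom_lincomb c (to_free f) (to_free g).
Proof. by apply: ahom_ext => x; exact: ahomL. Qed.

Lemma thom_id (P Q : fgproj k) : thom (ahom_id P) (ahom_id Q) =1 ahom_id (tobj P Q).
Proof. by move=> x; rewrite /thom !to_free_id ftens_id. Qed.
Lemma thom_comp (P P' P'' Q Q' Q'' : fgproj k)
      (f' : ahom P' P'') (f : ahom P P') (g' : ahom Q' Q'') (g : ahom Q Q') :
  thom (ahom_comp f' f) (ahom_comp g' g) =1 ahom_comp (thom f' g') (thom f g).
Proof. by move=> x; rewrite /thom !to_free_comp ftens_comp. Qed.
Lemma thom_linl (P P' Q Q' : fgproj k) (c : k) (f f' : ahom P P') (g : ahom Q Q') :
  thom (ahom_lincomb c f f') g =1 ahom_lincomb c (thom f g) (thom f' g).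
Proof. by move=> x; rewrite /thom !to_free_lincomb ftens_linl. Qed.
Lemma thom_linr (P P' Q Q' : fgproj k) (c : k) (f : ahom P P') (g g' : ahom Q Q') :
  thom f (ahom_lincomb c g g') =1 ahom_lincomb c (thom f g) (thom f g').
Proof. by move=> x; rewrite /thom !to_free_lincomb ftens_linr. Qed.

Section OnPn.
Context (n : nat).
Definition nu1 (_ : unit) : nat := n.
Definition one_in : ahom (Fmod k nu1 : amodType k) (Pfg k n) := @single k unit nu1 tt.
Lemma one_in_bij : bijective one_in.
Proof. by apply: single_bij => -[]. Qed.
Definition one_out : ahom (Pfg k n) (Fmod k nu1 : amodType k) :=
  projT1 (cid (ahom_inv one_in_bij)).
Lemma one_inK : cancel one_in one_out.
Proof. by rewrite /one_out; case: cid => ? []. Qed.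
Lemma one_outK : cancel one_out one_in.
Proof. by rewrite /one_out; case: cid => ? []. Qed.
(** The free form chosen for $P_n$ is opaque; [to_one] and [of_one] identify it with the standard
    one having a single summand. *)
Definition to_one : ahom (Fmod k (@free_nu k (Pfg k n)) : amodType k) (Fmod k nu1) :=
  ahom_comp one_out (free_in (Pfg k n)).
Definition of_one : ahom (Fmod k nu1 : amodType k) (Fmod k (@free_nu k (Pfg k n))) :=
  ahom_comp (free_out (Pfg k n)) one_in.
Lemma to_oneK : ahom_comp of_one to_one = ahom_id _.
Proof.
by apply: ahom_ext => x; exact: etrans (congr1 (free_out _) (one_outK _)) (free_inK _).
Qed.
Lemma of_oneK : ahom_comp to_one of_one = ahom_id _.
Proof.
by apply: ahom_ext => x; exact: etrans (congr1 one_out (@free_outK (Pfg k n) (one_in x))) (one_inK x).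
Qed.
End OnPn.

Section OnPnm.
Context (n m : nat).
Definition one2_in : ahom (Fmod k (addnu (nu1 n) (nu1 m)) : amodType k) (Pfg k (n + m)) :=
  @single k (unit * unit)%type (addnu (nu1 n) (nu1 m)) (tt, tt).
Lemma one2_in_bij : bijective one2_in.
Proof. by apply: single_bij => -[[] []]. Qed.
Definition tPn : ahom (tobj (Pfg k n) (Pfg k m)) (Pfg k (n + m)) :=
  ahom_comp one2_in (ftens (to_one n) (to_one m)).
Lemma tPn_bij : bijective tPn.
Proof.
apply: bij_comp one2_in_bij _; exists (ftens (of_one n) (of_one m)) => x.
  by rewrite -[LHS]/(ahom_comp _ _ x) -ftens_comp !to_oneK ftens_id.
by rewrite -[LHS]/(ahom_comp _ _ x) -ftens_comp !of_oneK ftens_id.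
Qed.
End OnPnm.

Definition rmul1 (d : diagram) : ahom (Fmod k (nu1 (dleft d)) : amodType k) (Fmod k (nu1 (dright d))) :=
  ahom_comp (one_out (dright d)) (ahom_comp (rmul k d) (one_in (dleft d))).

(** Naturality of this identification, which reduces [tdiagram] to one-by-one matrices. *)
Lemma to_one_rmul d : ahom_comp (to_one (dright d)) (to_free (rmul k d)) =
  ahom_comp (rmul1 d) (to_one (dleft d)).
Proof.
apply: ahom_ext => x; transitivity (one_out (dright d) (rmul k d (free_in _ x))).
  rewrite -[LHS]/(one_out (dright d) (free_in (Pfg k (dright d))
    (free_out (Pfg k (dright d)) (rmul k d (free_in _ x))))).
  by rewrite free_outK.
rewrite -[RHS]/(one_out (dright d) (rmul k d (one_in (dleft d)
  (one_out (dleft d) (free_in (Pfg k (dleft d)) x))))).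
by rewrite one_outK.
Qed.

Lemma entry_rmul1 d : entry (rmul1 d) tt tt = basis k d.
Proof.
have H x : fcoord (one_out (dright d) x) tt = Pn_val x.
  by rewrite -{2}(one_outK x).
by rewrite /entry [LHS]H /= fcoord_one eqxx id_basis eqxx.
Qed.

Lemma one2_rmul a b : ahom_comp (one2_in (dright a) (dright b)) (ftens (rmul1 a) (rmul1 b)) =
  ahom_comp (rmul k (dtens a b)) (one2_in (dleft a) (dleft b)).
Proof.
(* It suffices to compare the images of the single generator; both are the diagram [dtens a b]. *)
apply: ahom_ext; apply: ahom_Fmod_ext => -[[] []]; apply: val_inj.
transitivity (entry (ftens (rmul1 a) (rmul1 b)) (tt, tt) (tt, tt)); first by [].
rewrite entry_ftens !entry_rmul1 tensA_basis.
transitivity (mulA (fcoord (fone k (addnu (nu1 (dleft a)) (nu1 (dleft b))) (tt, tt)) (tt, tt))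
  (basis k (dtens a b))); last by [].
by rewrite fcoord_one eqxx id_basis eqxx.
Qed.

Lemma tdiagram a b :
  ahom_comp (tPn (dright a) (dright b)) (thom (rmul k a) (rmul k b))
  =1 ahom_comp (rmul k (dtens a b)) (tPn (dleft a) (dleft b)).
Proof.
move=> x; rewrite /tPn /thom.
transitivity (ahom_comp (one2_in (dright a) (dright b))
  (ftens (ahom_comp (to_one (dright a)) (to_free (rmul k a)))
         (ahom_comp (to_one (dright b)) (to_free (rmul k b)))) x).
  by rewrite ftens_comp.
rewrite !to_one_rmul ftens_comp.
transitivity (ahom_comp (one2_in (dright a) (dright b)) (ftens (rmul1 a) (rmul1 b))
  (ftens (to_one (dleft a)) (to_one (dleft b)) x)); first by [].
by rewrite one2_rmul.
Qed.

Definition tensor_product_ex : tensor_product k :=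
  TensorProduct thom_id thom_comp thom_linl thom_linr tPn_bij tdiagram.
End TensorExists.

(** * Euler characteristics of resolutions *)

Section Submodule.
Context (k : fieldType) (M : amodType k) (S : asubmod M).

Record subm := Subm { subm_val : M; subm_valP : subm_val \in asub_pred S }.
HB.instance Definition _ := [isSub for subm_val].
HB.instance Definition _ := [Choice of subm by <:].
HB.instance Definition _ := [SubChoice_isSubLmodule of subm by <:].

Lemma subm_valL c (x y : subm) : subm_val (c *: x + y) = c *: subm_val x + subm_val y.
Proof. exact: (linearP (val : subm -> M)). Qed.

Definition subm_act (a : Aminus k) (x : subm) : subm := Subm (asub_act a (subm_valP x)).

Lemma subm_act_linl (c : k) (a b : Aminus k) (x : subm) :
  subm_act (c *: a + b) x = c *: subm_act a x + subm_act b x.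
Proof. by apply: val_inj; rewrite [RHS]subm_valL; exact: act_linl. Qed.
Lemma subm_act_linr (a : Aminus k) (c : k) (x y : subm) :
  subm_act a (c *: x + y) = c *: subm_act a x + subm_act a y.
Proof. by apply: val_inj; rewrite [RHS]subm_valL -act_linr -subm_valL. Qed.
Lemma subm_actM (a b : Aminus k) (x : subm) : subm_act (mulA a b) x = subm_act a (subm_act b x).
Proof. by apply: val_inj; exact: actM. Qed.
Lemma subm_act_unital (x : subm) : exists N, x = \sum_(m < N) subm_act (idA k m) x.
Proof.
have [N E] := act_unital (subm_val x); exists N; apply: val_inj.
by rewrite raddf_sum; exact: E.
Qed.

HB.instance Definition _ := isAModule.Build k subm
  subm_act_linl subm_act_linr subm_actM subm_act_unital.

Definition subm_incl : ahom (subm : amodType k) M :=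
  @ahom_of k (subm : amodType k) M subm_val subm_valL (fun _ _ => erefl).
End Submodule.

Section Homological.
Context (k : fieldType).
Implicit Types A B C K M N : amodType k.

Definition ses A B C (i : ahom A B) (p : ahom B C) : Prop :=
  [/\ forall x, i x = 0 -> x = 0, forall y, exists x, p x = y &
      forall x, p x = 0 <-> exists z, i z = x].

Lemma ses_comp0 A B C (i : ahom A B) (p : ahom B C) z : ses i p -> p (i z) = 0.
Proof. by move=> [_ _ H]; apply/H; exists z. Qed.

Lemma ses_inj A B C (i : ahom A B) (p : ahom B C) : ses i p -> injective i.
Proof.
move=> [H _ _] x y E; apply/eqP; rewrite -subr_eq0; apply/eqP/H.
by rewrite ahomB E subrr.
Qed.

Section Kernel.
Context M N (p : ahom M N).
Definition ker_pred : {pred M} := fun x => p x == 0.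
Lemma ker_submod : submod_closed ker_pred.
Proof.
split=> [|c x y]; rewrite !unfold_in ?ahom_f0 // => /eqP Hx /eqP Hy.
by rewrite ahomL Hx Hy scaler0 addr0.
Qed.
Lemma ker_act (a : Aminus k) (x : M) : x \in ker_pred -> act a x \in ker_pred.
Proof. by rewrite !unfold_in ahom_act => /eqP->; rewrite act0r. Qed.
Definition ker_asub : asubmod M := ASubmod ker_submod ker_act.

Lemma kernel_ex : (forall y, exists x, p x = y) -> exists K (i : ahom K M), ses i p.
Proof.
move=> sur; exists (subm ker_asub : amodType k), (subm_incl ker_asub); split=> // [x E|x].
  by apply: val_inj.
split=> [E|[[y Hy] <-]]; last exact/eqP.
by exists (@Subm _ _ ker_asub x (introT eqP E)).
Qed.
End Kernel.

Lemma ses_factor A B C Z (i : ahom A B) (p : ahom B C) (h : ahom Z B) :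
  ses i p -> (forall z, p (h z) = 0) -> exists g : ahom Z A, forall z, i (g z) = h z.
Proof.
move=> S E; have [_ _ ex] := S; have inj := ses_inj S.
have H z : exists x, i x = h z by apply/ex.
pose g z := projT1 (cid (H z)); have gE z : i (g z) = h z by rewrite /g; case: cid.
have gl : linear g by move=> c x y; apply: inj; rewrite ahomL !gE ahomL.
have ga a x : g (act a x) = act a (g x) by apply: inj; rewrite ahom_act !gE ahom_act.
by exists (ahom_of gl ga).
Qed.

Lemma ses_iso_r A B C D (i : ahom A B) (p : ahom B C) (u : ahom C D) :
  bijective u -> ses i p -> ses i (ahom_comp u p).
Proof.
move=> [v uK vK] [inj sur ex]; split=> // [y|x].
  by have [x E] := sur (v y); exists x; rewrite /= E vK.
rewrite -ex /=; split=> [E|->]; last exact: ahom_f0.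
by rewrite -[p x]uK E -(ahom_f0 u) uK.
Qed.

(** Both sides are the pullback of [p] and [p']. With lifts [s] of [p] and [t] of [p'], the
    isomorphism sends $(a,b')$ to $(a',b)$, where $b=i(a)+t(b')$ and $i'(a')=b'-s(b)$. *)
Lemma schanuel A B A' B' C (i : ahom A B) (p : ahom B C) (i' : ahom A' B') (p' : ahom B' C) :
  aprojective B -> aprojective B' -> ses i p -> ses i' p' -> aiso (A * B')%type (A' * B)%type.
Proof.
move=> pB pB' S S'; have [inj sur ex] := S; have [inj' sur' ex'] := S'.
have [s sE] := pB _ _ p' p sur'; have [t tE] := pB' _ _ p p' sur.
pose x1 : ahom (A * B')%type B := ahom_copair i t.
pose y1 : ahom (A * B')%type B' := ahom_lincomb (-1) (ahom_comp s x1) (ahom_snd A B').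
have x1E z : x1 z = i z.1 + t z.2 by exact: ahom_copairE.
have y1E z : y1 z = z.2 - s (x1 z) by rewrite /= scaleN1r addrC.
have [g gE] : exists g : ahom (A * B')%type A', forall z, i' (g z) = y1 z.
  apply: ses_factor S' _ => z.
  by rewrite y1E ahomB sE x1E ahomD (ses_comp0 _ S) add0r tE subrr.
exists (ahom_pair g x1); apply: ahom_bij => [[a b] E|[a' b]].
  have Ex : x1 (a, b) = 0 := congr1 snd E.
  have Eg : g (a, b) = 0 := congr1 fst E.
  have Eb : b = 0.
    by have := gE (a, b); rewrite Eg ahom_f0 y1E Ex ahom_f0 subr0.
  move: Ex; rewrite x1E /= Eb ahom_f0 addr0 => /inj ->.
  by [].
pose b' := i' a' + s b.
have [a Ea] : exists a, i a = b - t b'.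
  by apply/ex; rewrite ahomB tE ahomD (ses_comp0 _ S') add0r sE subrr.
exists (a, b'); have Ex : x1 (a, b') = b by rewrite x1E /= Ea subrK.
congr pair; last exact: Ex.
by apply: (ses_inj S'); rewrite gE y1E Ex /b' addrK.
Qed.

Lemma ses_prod A B C M (i : ahom A B) (p : ahom B C) : ses i p ->
  ses (ahom_pair i (ahom0 A M)) (ahom_pair (ahom_comp p (ahom_fst B M)) (ahom_snd B M)).
Proof.
move=> S; have [inj sur ex] := S; split.
- by move=> x E; apply: inj; exact: (congr1 fst E).
- by move=> [y m]; have [x E] := sur y; exists (x, m); rewrite /= /pair_fun /= E.
move=> [x m]; split=> [E|[z <-]].
  have /ex[z Ez] : p x = 0 := congr1 fst E.
  have Em : m = 0 := congr1 snd E.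
  by exists z; rewrite /= /pair_fun /= Ez Em.
by rewrite /= /pair_fun /= (ses_comp0 z S).
Qed.

(* M has a resolution of length < n by finitely generated projectives, with Euler characteristic c. *)
Fixpoint euler n M (c : {poly int}) : Prop :=
  match n with
  | 0 => (forall x : M, x = 0) /\ c = 0
  | n.+1 => exists (Q : fgproj k) (K : amodType k) (i : ahom K Q) (p : ahom Q M) (c' : {poly int}),
      [/\ ses i p, euler n K c' & c = rk Q - c']
  end.

Lemma euler_iso n M N c : aiso M N -> euler n M c -> euler n N c.
Proof.
move=> [u ub]; case: n => [[H ->]|n [Q [K [i [p [c' [S E ->]]]]]]].
  by split=> // y; have [v _ vK] := ub; rewrite -[y]vK (H (v y)) ahom_f0.
by exists Q, K, i, (ahom_comp u p), c'; split=> //; exact: ses_iso_r.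
Qed.

(** Padding by a zero module, so that two resolutions can be compared at a common length. *)
Lemma euler_succ n M c : euler n M c -> euler n.+1 M c.
Proof.
elim: n M c => [|n IH] M c.
  move=> [H ->]; exists (zero_fg k), (zero_fg k), (ahom0 _ _), (ahom0 _ _), 0; split=> //.
  - split=> [x _|y|x]; first exact: zero_fgE.
      by exists 0; rewrite (H y).
    by split=> // _; exists 0; exact/esym/zero_fgE.
  - by split=> // x; exact: zero_fgE.
  - by rewrite subr0 rk0 //; exact: zero_fgE.
by move=> [Q [K [i [p [c' [S /IH E ->]]]]]]; exists Q, K, i, p, c'.
Qed.

Lemma euler_le m n M c : (m <= n)%N -> euler m M c -> euler n M c.
Proof. by move=> /subnKC <-; elim: (n - m)%N => [|d IH]; rewrite ?addn0 // addnS => /IH/euler_succ. Qed.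

(** Schanuel's lemma makes kernels isomorphic only after adding projectives, so the induction has to
    start from $M\oplus P\cong N\oplus Q$. The summands are added to the projectives covering $M$
    and $N$, which leaves the kernels unchanged. *)
Lemma euler_uniq_gen n M N c d (P Q : fgproj k) :
  aiso (M * P)%type (N * Q)%type -> euler n M c -> euler n N d -> c + rk P = d + rk Q.
Proof.
elim: n M N c d P Q => [|n IH] M N c d P Q I.
  move=> [HM ->] [HN ->]; congr (_ + _); apply: rk_iso.
  have Z (L : amodType k) (R : fgproj k) : (forall x : L, x = 0) -> aiso R (L * R)%type.
    by move=> H; exists (ahom_inr L R), snd => // -[x y] /=; rewrite /pair_fun /= (H x).
  exact: aiso_trans (Z _ P HM) (aiso_trans I (aiso_sym (Z _ Q HN))).
move=> [R [K [i [p [c' [S E ->]]]]]] [R' [K' [i' [p' [d' [S' E' ->]]]]]].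
have [u ub] := I.
have X := schanuel (@prod_proj k R P) (@prod_proj k R' Q) (ses_iso_r ub (ses_prod P S)) (ses_prod Q S').
have := IH _ _ _ _ (prod_fg R' Q) (prod_fg R P) X E E'.
rewrite !rk_prod => H.
have -> : rk R - c' + rk P = (d' + (rk R + rk P)) - c' - d' by ring.
by rewrite -H; ring.
Qed.

Lemma euler_uniq m n M c d : euler m M c -> euler n M d -> c = d.
Proof.
move=> /(euler_le (leq_maxl m n)) Ec /(euler_le (leq_maxr m n)) Ed.
exact: (addIr _ (euler_uniq_gen (P := zero_fg k) (aiso_refl _) Ec Ed)).
Qed.

(** The cover of [C] lifts to [B], so $Q_A\oplus Q_C$ covers [B]; the kernels of the three covers
    form a short exact sequence again, and induction applies. *)
Lemma horseshoe n A B C a c (i : ahom A B) (p : ahom B C) :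
  ses i p -> euler n A a -> euler n C c -> euler n B (a + c).
Proof.
elim: n A B C a c i p => [|n IH] A B C a c i p S.
  move=> [HA ->] [HC ->]; split=> [b|]; last by rewrite addr0.
  have [_ _ ex] := S; have /ex[z <-] := HC (p b).
  by rewrite (HA z) ahom_f0.
move=> [QA [KA [iA [pA [a' [SA EA ->]]]]]] [QC [KC [iC [pC [c' [SC EC ->]]]]]].
have [injA surA exA] := SA; have [injC surC exC] := SC; have [inj sur ex] := S.
have [h hE] := fgproj_proj pC sur.
pose pB : ahom (prod_fg QA QC) B := ahom_copair (ahom_comp i pA) h.
have pBE z : pB z = i (pA z.1) + h z.2 by exact: ahom_copairE.
have surB b : exists x, pB x = b.
  have [z Ez] := surC (p b).
  have /ex[x Ex] : p (b - h z) = 0 by rewrite ahomB hE Ez subrr.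
  have [y Ey] := surA x; exists (y, z); by rewrite pBE /= Ey Ex subrK.
have [K [j SK]] := kernel_ex surB; have [injK _ exK] := SK.
have [f fE] : exists f : ahom KA K, forall z, j (f z) = ahom_pair iA (ahom0 _ _) z.
  by apply: ses_factor SK _ => z; rewrite pBE /= (ses_comp0 _ SA) !ahom_f0 addr0.
have [g gE] : exists g : ahom K KC, forall z, iC (g z) = ahom_comp (ahom_snd QA QC) j z.
  apply: ses_factor SC _ => z; rewrite -hE.
  have := ses_comp0 z SK; rewrite pBE => /(congr1 p).
  by rewrite ahomD (ses_comp0 _ S) add0r ahom_f0.
exists (prod_fg QA QC), K, j, pB, (a' + c'); split; first by split.
  apply: (IH KA K KC a' c' f g) EA EC; split.
  - by move=> x E; apply: injA; have := fE x; rewrite E ahom_f0 => /(congr1 fst)/esym.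
  - move=> y; have /ex[x Ex] : p (h (iC y)) = 0 by rewrite hE; exact: ses_comp0.
    have [q Eq] := surA x.
    have /exK[w Ew] : pB (- q, iC y) = 0 by rewrite pBE /= !ahomN Eq Ex addNr.
    by exists w; apply: (ses_inj SC); rewrite gE /= Ew.
  - move=> w; split=> [E|[z <-]].
      have E2 : (j w).2 = 0 by have := gE w; rewrite E ahom_f0.
      have := ses_comp0 w SK; rewrite pBE E2 ahom_f0 addr0 => /inj/exA[z Ez].
      exists z; apply: (ses_inj SK); rewrite fE /= /pair_fun /= Ez -E2.
      by case: (j w).
    by apply: injC; rewrite gE /= fE.
by rewrite rk_prod opprD addrACA.
Qed.

(** A cover [Q] of [B], with kernel [K], also covers [C]. The kernel [D] of $Q\to C$ is an extension
    of [A] by [K], so the horseshoe lemma applies to it, and the length grows by one. *)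
Lemma euler_cone n A B C a b (i : ahom A B) (p : ahom B C) :
  ses i p -> euler n A a -> euler n B b -> euler n.+1 C (b - a).
Proof.
move=> S; have [inj sur ex] := S; case: n => [[HA ->] [HB ->]|n EA].
  rewrite subr0; apply: euler_succ; split=> // y.
  by have [x <-] := sur y; rewrite (HB x) ahom_f0.
move=> [Q [K [j [q [c [SQ EK ->]]]]]]; have [injQ surQ exQ] := SQ.
pose r : ahom Q C := ahom_comp p q.
have surr y : exists x, r x = y.
  by have [x Ex] := sur y; have [z Ez] := surQ x; exists z; rewrite /= Ez Ex.
have [D [l SD]] := kernel_ex surr; have [injD _ exD] := SD.
have [f fE] : exists f : ahom K D, forall z, l (f z) = j z.
  by apply: ses_factor SD _ => z; rewrite /= (ses_comp0 _ SQ) ahom_f0.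
have [g gE] : exists g : ahom D A, forall z, i (g z) = ahom_comp q l z.
  by apply: ses_factor S _ => z; exact: (ses_comp0 z SD).
exists Q, D, l, r, (c + a); split; [by split| |by rewrite opprD addrA].
apply: (horseshoe (i := f) (p := g)) (euler_succ EK) EA; split.
- by move=> x E; apply: injQ; rewrite -fE E ahom_f0.
- move=> y; have [x Ex] := surQ (i y).
  have /exD[z Ez] : r x = 0 by rewrite /= Ex; exact: ses_comp0.
  by exists z; apply: (ses_inj S); rewrite gE /= Ez Ex.
- move=> w; split=> [E|[z <-]].
    have /exQ[z Ez] : q (l w) = 0 by have := gE w; rewrite E ahom_f0.
    by exists z; apply: (ses_inj SD); rewrite fE.
  by apply: inj; rewrite gE /= fE; exact: ses_comp0.
Qed.

Lemma euler_fgproj (P : fgproj k) : euler 1 P (rk P).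
Proof.
exists P, (zero_fg k), (ahom0 _ _), (ahom_id P), 0; split; last by rewrite subr0.
  split=> [x _|y|x]; [exact: zero_fgE|by exists y|].
  by split=> [E|[z <-] //]; exists 0; exact: esym E.
by split=> // x; exact: zero_fgE.
Qed.

(** Removing the projective in degree 0 leaves a shorter complex that resolves the kernel of the
    augmentation. *)
Lemma exact_euler n (Q : nat -> fgproj k) (d : forall i, ahom (Q i.+1) (Q i)) M
    (aug : ahom (Q 0%N) M) :
  (forall i, (n <= i)%N -> forall x : Q i, x = 0) ->
  (forall y, exists x, aug x = y) ->
  (forall x, aug x = 0 <-> exists z, d 0%N z = x) ->
  (forall i x, d i x = 0 <-> exists z, d i.+1 z = x) ->
  euler n M (\sum_(i < n) (-1) ^+ i * rk (Q i)).
Proof.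
elim: n Q d M aug => [|n IH] Q d M aug z0 sur ex0 ex.
  split; last by rewrite big_ord0.
  by move=> y; have [x <-] := sur y; rewrite (z0 0%N _ x) // ahom_f0.
have [K [i S]] := kernel_ex sur; have [inj _ exK] := S.
have [aug' augE] : exists g : ahom (Q 1%N) K, forall z, i (g z) = d 0%N z.
  by apply: ses_factor S _ => z; apply/ex0; exists z.
exists (Q 0%N), K, i, aug, (\sum_(j < n) (-1) ^+ j * rk (Q j.+1)); split=> //.
  apply: (IH (fun j => Q j.+1) (fun j => d j.+1) K aug') => //.
  - by move=> j lt; apply: z0.
  - move=> y; have /ex0[z Ez] : aug (i y) = 0 by exact: ses_comp0.
    by exists z; apply: (ses_inj S); rewrite augE.
  - move=> x; rewrite -ex; split=> [E|E]; first by rewrite -augE E ahom_f0.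
    by apply: inj; rewrite augE.
rewrite big_ord_recl expr0 mul1r; congr (_ + _).
by rewrite -sumrN; apply: eq_bigr => j _; rewrite exprS mulN1r mulNr.
Qed.

Lemma resolution_euler M (R : resolution M) : euler (res_len R).+1 M (K0_rk (res_class R)).
Proof.
have -> : K0_rk (res_class R) = \sum_(i < (res_len R).+1) (-1) ^+ i * rk (res_obj R i).
  rewrite /res_class (big_morph (@K0_rk k) (@K0_rkD k) (@K0_rk0 k)).
  apply: eq_bigr => i _; rewrite -signr_odd; case: (odd i).
    by rewrite K0_rkN K0_rk_cls mulN1r.
  by rewrite K0_rk_cls mul1r.
exact: (exact_euler (d := @res_d _ _ R) (aug := res_aug R) (@res_zero _ _ R)
  (@res_aug_surj _ _ R) (@res_exact0 _ _ R) (@res_exact _ _ R)).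
Qed.

Section Splice.
Context (Q : fgproj k) K M (i : ahom K Q) (p : ahom Q M) (S : ses i p) (R : resolution K).
(** The Yoneda splice: a resolution of the kernel [K], shifted by one, with [Q] put in degree 0. *)
Definition splice_obj j := if j is j'.+1 then res_obj R j' else Q.
Definition splice_d j : ahom (splice_obj j.+1) (splice_obj j) :=
  match j with 0 => ahom_comp i (res_aug R) | j'.+1 => res_d R j' end.
Lemma splice_zero j : ((res_len R).+1 < j)%N -> forall x : splice_obj j, x = 0.
Proof. by case: j => // j lt; exact: res_zero. Qed.
Lemma splice_surj y : exists x, p x = y.
Proof. by case: S. Qed.
Lemma splice_exact0 x : p x = 0 <-> exists z, splice_d 0 z = x.
Proof.
have [_ _ ->] := S; split=> [[y <-]|[z <-]]; last by exists (res_aug R z).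
by have [z <-] := res_aug_surj R y; exists z.
Qed.
Lemma splice_exact j (x : splice_obj j.+1) :
  splice_d j x = 0 <-> exists z, splice_d j.+1 z = x.
Proof.
case: j x => [|j] x; last exact: res_exact.
rewrite -[splice_d 0 x]/(i (res_aug R x)) -[splice_d 1]/(res_d R 0) -res_exact0.
by split=> [|->]; [case: S => H _ _; exact: H|exact: ahom_f0].
Qed.
Definition splice : resolution M :=
  Resolution splice_zero splice_surj splice_exact0 splice_exact.
End Splice.

Lemma euler_resolution n M c : euler n M c -> inhabited (resolution M).
Proof.
elim: n M c => [|n IH] M c.
  move=> [H _]; constructor.
  pose Z (_ : nat) := zero_fg k; pose dZ j : ahom (Z j.+1) (Z j) := ahom0 _ _.
  have ex j (x : Z j.+1) : dZ j x = 0 <-> exists z, dZ j.+1 z = x.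
    by split=> // _; exists 0; exact/esym/zero_fgE.
  apply: (@Resolution k M 0%N Z dZ (ahom0 _ _)) => //.
  - by move=> j _ x; exact: zero_fgE.
  - by move=> y; exists 0; rewrite (H y).
  - by move=> x; split=> // _; exists 0; exact/esym/zero_fgE.
move=> [Q [K [i [p [c' [S /IH[R] _]]]]]]; constructor; exact: (splice S R).
Qed.

End Homological.

(** * Standard modules *)

Section QuotientMaps.
Context (k : fieldType).

Section QMap.
Context (M N : amodType k) (S : asubmod M) (T : asubmod N) (f : ahom M N).
Context (fS : forall x, x \in S -> f x \in T).
Definition qmap_fun (q : aquot S) : aquot T := aquot_pi T (f (repr q)).
Lemma qmap_pi x : qmap_fun (aquot_pi S x) = aquot_pi T (f x).
Proof.
apply/aquot_piP; rewrite -ahomB; apply: fS; apply/aquot_piP; exact: aquot_reprK.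
Qed.
Lemma qmap_linear : linear qmap_fun.
Proof.
move=> c q r; elim/aquot_ind: q => x; elim/aquot_ind: r => y.
by rewrite -aquot_pi_linear !qmap_pi ahomL aquot_pi_linear.
Qed.
Lemma qmap_act a q : qmap_fun (act a q) = act a (qmap_fun q).
Proof.
elim/aquot_ind: q => x; have E (L : amodType k) (U : asubmod L) z :
  act a (aquot_pi U z) = aquot_pi U (act a z) by exact: aquot_pi_act.
by rewrite E !qmap_pi ahom_act E.
Qed.
Definition qmap : ahom (aquot S : amodType k) (aquot T) := ahom_of qmap_linear qmap_act.
Lemma qmapE x : qmap (aquot_pi S x) = aquot_pi T (f x).
Proof. exact: qmap_pi. Qed.
End QMap.

Lemma aquot_pi0 (M : amodType k) (S : asubmod M) x : aquot_pi S x = 0 <-> x \in S.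
Proof.
have <- : aquot_pi S 0 = 0.
  by have := aquot_pi_linear S (-1) 0 0; rewrite scaler0 addr0 scaleN1r addNr.
by split=> [/aquot_piP|H]; [|apply/aquot_piP]; rewrite subr0.
Qed.

Lemma aquot_surj (M : amodType k) (S : asubmod M) (q : aquot S) : exists x, aquot_pi S x = q.
Proof. by exists (repr q); exact: aquot_reprK. Qed.

Lemma aquot_trivial (M : amodType k) (S : asubmod M) :
  (forall x, x \in S -> x = 0) -> aiso M (aquot S : amodType k).
Proof.
move=> H.
have pa a x : aquot_pi S (act a x) = act a (aquot_pi S x) by exact/esym/aquot_pi_act.
exists (@ahom_of k M (aquot S : amodType k) _ (aquot_pi_linear S) pa).
by apply: ahom_bij => [x /aquot_pi0/H //|y]; exact: aquot_surj.
Qed.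

Lemma aquot_eq (M : amodType k) (S T : asubmod M) :
  (forall x, (x \in S) = (x \in T)) -> aiso (aquot S : amodType k) (aquot T).
Proof.
move=> E; have ST x : x \in S -> ahom_id M x \in T by rewrite -E.
exists (qmap ST); apply: ahom_bij => [q|q].
  by elim/aquot_ind: q => x; rewrite qmapE => /aquot_pi0; rewrite -E => /aquot_pi0.
by have [x <-] := aquot_surj q; exists (aquot_pi S x); rewrite qmapE.
Qed.

(** The hypotheses amount to $f^{-1}(T)=S$ and $U=f(M)+T$, which give $0\to M/S\to N/T\to N/U\to
    0$. *)
Lemma ses_aquot (M N : amodType k) (S : asubmod M) (T U : asubmod N) (f : ahom M N)
    (fS : forall x, x \in S -> f x \in T) (TU : forall y, y \in T -> ahom_id N y \in U) :
  (forall x, f x \in T -> x \in S) -> (forall x, f x \in U) ->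
  (forall y, y \in U -> exists x, y - f x \in T) -> ses (qmap fS) (qmap TU).
Proof.
move=> fT fU ex; split.
- by move=> q; elim/aquot_ind: q => x; rewrite qmapE => /aquot_pi0/fT/aquot_pi0.
- by move=> q; have [x <-] := aquot_surj q; exists (aquot_pi T x); rewrite qmapE.
move=> q; elim/aquot_ind: q => y; split=> [|[z <-]].
  by rewrite qmapE => /aquot_pi0/ex[x /aquot_piP E]; exists (aquot_pi S x); rewrite qmapE.
by elim/aquot_ind: z => x; rewrite !qmapE; apply/aquot_pi0; exact: fU.
Qed.
End QuotientMaps.

(** * Inserting and deleting a right sarc *)

Section Cupping.
Context (a n : nat) (le_an : (a <= n)%N).
Local Open Scope fset_scope.

Lemma bump_mono i j : (bump a i < bump a j)%N = (i < j)%N.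
Proof. by rewrite !ltnNge leq_bump2. Qed.
Lemma bump_lt i : (bump a i < n.+1)%N = (i < n)%N.
Proof.
by rewrite /bump; case: (leqP a i) => h; rewrite ?add1n ?add0n ?ltnS //; lia.
Qed.

(** [bump a] is the increasing injection that misses [a], so the right point [a] carries a sarc;
    [delete_larcs] is the mirror image. *)
Definition insert_larcs : {fset nat * nat} := [fset (i, bump a i) | i in iota 0 n].
Definition delete_larcs : {fset nat * nat} := [fset (bump a i, i) | i in iota 0 n].

Lemma insert_larcsP i j : ((i, j) \in insert_larcs) = (i < n)%N && (j == bump a i).
Proof.
apply/imfsetP/andP => /= [[l]|[lt /eqP->]].
  by rewrite mem_iota /= => lt [-> ->].
by exists i => //; rewrite mem_iota.
Qed.
Lemma delete_larcsP i j : ((i, j) \in delete_larcs) = (j < n)%N && (i == bump a j).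
Proof.
apply/imfsetP/andP => /= [[l]|[lt /eqP->]].
  by rewrite mem_iota /= => lt [-> ->].
by exists j => //; rewrite mem_iota.
Qed.

Lemma insert_subproof : is_diagram ((n, n.+1), insert_larcs).
Proof.
apply/is_diagramP; split.
  by move=> [i j]; rewrite insert_larcsP => /andP[lt /eqP->] /=; rewrite bump_lt lt.
move=> [i j] [i' j']; rewrite !insert_larcsP => /andP[_ /eqP->] /andP[_ /eqP->] /=.
by rewrite bump_mono.
Qed.
Definition dinsert : diagram := Diagram insert_subproof.
Lemma larcs_insertE i j : ((i, j) \in larcs dinsert) = (i < n)%N && (j == bump a i).
Proof. exact: insert_larcsP. Qed.

Lemma delete_subproof : is_diagram ((n.+1, n), delete_larcs).
Proof.
apply/is_diagramP; split.
  by move=> [i j]; rewrite delete_larcsP => /andP[lt /eqP->] /=; rewrite bump_lt lt.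
move=> [i j] [i' j']; rewrite !delete_larcsP => /andP[_ /eqP->] /andP[_ /eqP->] /=.
by rewrite bump_mono.
Qed.
Definition ddelete : diagram := Diagram delete_subproof.
Lemma larcs_deleteE i j : ((i, j) \in larcs ddelete) = (j < n)%N && (i == bump a j).
Proof. exact: delete_larcsP. Qed.

Lemma composable_insert d : dright d = n -> composable d dinsert.
Proof.
move=> E; apply/composableP; split=> // j lt; right; exists (bump a j).
by rewrite larcs_insertE eqxx andbT -E.
Qed.

Lemma dcat_insert_delete d : dright d = n -> dcat (dcat d dinsert) ddelete = d.
Proof.
move=> E; rewrite -dcatA; have -> : dcat dinsert ddelete = did (dright d).
  rewrite E; apply: diagram_eq => //; apply/fsetP => -[i l]; rewrite [RHS]larcs_idP.
  apply/larcs_catP/andP => [[j []]|[/eqP<- lt]].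
    rewrite larcs_insertE => /andP[lt /eqP->].
    by rewrite larcs_deleteE => /andP[_ /eqP/(can_inj (bumpK a)) <-].
  by exists (bump a i); rewrite larcs_insertE larcs_deleteE lt eqxx.
exact: did_catr.
Qed.

(** The sarc at [a] meets a sarc of [ddelete] and is erased by [dcat] as a floating arc; the
    insertion puts it back. The other right points lie in the image of [bump a]. *)
Lemma dcat_delete_insert d : dright d = n.+1 -> right_sarc d a ->
  dcat (dcat d ddelete) dinsert = d.
Proof.
move=> E sa; apply: diagram_eq => //; apply/fsetP => -[i l].
apply/larcs_catP/idP => [[j [/larcs_catP[j' [h]]]]|h].
  rewrite larcs_deleteE => /andP[_ /eqP Ej'].
  by rewrite larcs_insertE => /andP[_ /eqP->]; rewrite -Ej'.
have /andP[_ lt] := larcs_bound h; rewrite E in lt.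
have ne : a != l.
  apply: contraTneq sa => ->; apply/(right_sarcPn _); first by rewrite E.
  by exists i.
have El : bump a (unbump a l) = l by rewrite unbumpKcond (eq_sym l) (negbTE ne).
have lt' : (unbump a l < n)%N by rewrite -bump_lt El.
exists (unbump a l); rewrite larcs_insertE lt' El eqxx; split=> //.
by apply/larcs_catP; exists l; rewrite larcs_deleteE lt' El eqxx.
Qed.

Lemma right_sarcP d j : reflect ((j < dright d)%N /\ forall i, (i, j) \notin larcs d) (right_sarc d j).
Proof.
apply: (iffP idP) => [H|[lt H]].
  have lt : (j < dright d)%N by case/andP: H.
  split=> // i; apply/negP => h; move/negP: (introT (right_sarcPn lt) (ex_intro _ i h)).
  by rewrite H.
by apply/negPn/negP => /(right_sarcPn lt)[i h]; move/negP: (H i).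
Qed.

(** Points below [a] are fixed by [bump a], so their sarcs keep their positions. *)
Lemma right_sarc_delete d j : (j < a)%N -> right_sarc d j -> right_sarc (dcat d ddelete) j.
Proof.
move=> lt /right_sarcP[_ H]; apply/right_sarcP; split=> [|i].
  exact: leq_trans lt le_an.
apply/larcs_catP => -[l [h]]; rewrite larcs_deleteE => /andP[_ /eqP E].
by move: h; rewrite E /bump leqNgt lt add0n; exact/negP.
Qed.

Lemma right_sarc_insert d j : (j < a)%N -> right_sarc d j -> right_sarc (dcat d dinsert) j.
Proof.
move=> lt /right_sarcP[_ H]; apply/right_sarcP; split=> [|i].
  by rewrite (leq_trans lt) // leqW.
apply/larcs_catP => -[l [h]]; rewrite larcs_insertE => /andP[_ /eqP E].
have El : l = j.
  by move: E lt; rewrite /bump; case: leqP => c; rewrite ?add1n ?add0n; lia.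
by move: h; rewrite El; exact/negP.
Qed.

Lemma right_sarc_inserted d : right_sarc (dcat d dinsert) a.
Proof.
apply/right_sarcP; split=> [|i]; first by rewrite ltnS.
apply/larcs_catP => -[l [_]]; rewrite larcs_insertE => /andP[_ /eqP E].
by have := neq_bump a l; rewrite -E eqxx.
Qed.
End Cupping.

(** * The quotients $N(n,a)$ of $P_n$ *)

Section SupportedOn.
Context (k : fieldType).

Definition supp_on (D : pred diagram) (x : Aminus k) : Prop := forall d, x@_d != 0 -> D d.

Lemma supp_on_basis (D : pred diagram) d : D d -> supp_on D (basis k d).
Proof.
by move=> H e; rewrite mcoeff_basis; case: (eqVneq d e) => [<-|]; rewrite ?eqxx.
Qed.
Lemma supp_on0 D : supp_on D 0.
Proof. by move=> d; rewrite mcoeff0 eqxx. Qed.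
Lemma supp_onL D c x y : supp_on D x -> supp_on D y -> supp_on D (c *: x + y).
Proof.
move=> Hx Hy d; rewrite mcoeffD mcoeffZ; have [->|/Hx //] := eqVneq x@_d 0.
by rewrite mulr0 add0r => /Hy.
Qed.
Lemma supp_onB D x y : supp_on D x -> supp_on D y -> supp_on D (x - y).
Proof. by move=> Hx Hy; rewrite addrC -scaleN1r; exact: supp_onL. Qed.

Lemma supp_on_lext (D E : pred diagram) g x : supp_on D x ->
  (forall d, D d -> supp_on E (g d)) -> supp_on E (lext g x).
Proof.
move=> Hx Hg; rewrite /lext big_seq; apply: big_ind => [|u v Hu Hv|d].
- exact: supp_on0.
- by rewrite -[u]scale1r; exact: supp_onL.
rewrite -mcoeff_neq0 => /Hx/Hg H; rewrite -[_ *: _]addr0; apply: supp_onL => //.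
exact: supp_on0.
Qed.
End SupportedOn.

Section Filtered.
Context (k : fieldType).

Definition sarc_below a : pred diagram := fun d => has (right_sarc d) (iota 0 a).
Lemma sarc_belowP a d : reflect (exists2 j, (j < a)%N & right_sarc d j) (sarc_below a d).
Proof. by apply: (iffP hasP) => -[j h1 h2]; exists j => //; move: h1; rewrite mem_iota. Qed.

Definition Sna_pred n a : {pred Pn k n} := fun x => all (sarc_below a) (msupp (Pn_val x)).
Arguments Sna_pred : clear implicits.
Lemma Sna_predP n a (x : Pn k n) : reflect (supp_on (sarc_below a) (Pn_val x)) (x \in Sna_pred n a).
Proof.
by apply: (iffP allP) => H d; [rewrite mcoeff_neq0|rewrite -mcoeff_neq0] => /H.
Qed.

Lemma Sna_submod n a : submod_closed (@Sna_pred n a).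
Proof.
split=> [|c x y /Sna_predP Hx /Sna_predP Hy]; apply/Sna_predP; first exact: supp_on0.
by rewrite Pn_valL; exact: supp_onL.
Qed.

Lemma Sna_act n a (u : Aminus k) (x : Pn k n) : x \in Sna_pred n a -> act u x \in Sna_pred n a.
Proof.
move=> /Sna_predP Hx; apply/Sna_predP.
suff H v : supp_on (sarc_below a) (mulA v (Pn_val x)) by exact: H.
elim/Aminus_ind: v => [|y|c v w Hv Hw].
- by rewrite mul0A; exact: supp_on0.
- rewrite mulA_lext lext_basis; apply: supp_on_lext Hx _ => d /sarc_belowP[j lt s].
  rewrite /dmul; case: ifP => C; last exact: supp_on0.
  by apply/supp_on_basis/sarc_belowP; exists j => //; exact: right_sarc_dcat.
- by rewrite mulA_linl; exact: supp_onL.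
Qed.

Definition Sna n a : asubmod (Pn k n) := ASubmod (@Sna_submod n a) (@Sna_act n a).
Definition Nna n a : amodType k := aquot (Sna n a).

Section Step.
Context (a n : nat) (le_an : (a <= n)%N).

Definition ins : ahom (Pn k n : amodType k) (Pn k n.+1) := rmul k (dinsert le_an).

Lemma ins_val (x : Pn k n) : Pn_val (ins x) = lext (fun d => dmul k d (dinsert le_an)) (Pn_val x).
Proof.
have -> : Pn_val (ins x) = mulA (Pn_val x) (basis k (dinsert le_an)) by [].
rewrite mulA_lext.
by apply: lext_ext => d; rewrite lext_basis.
Qed.

Lemma Pn_supp m (x : Pn k m) : supp_on (fun d => dright d == m) (Pn_val x).
Proof.
move=> d; rewrite -(eqP (Pn_valP x)) mcoeff_mul_id.
by case: (dright d == m); rewrite ?eqxx.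
Qed.

(** Not a product in $A^-$: on the diagrams of interest multiplication by [ddelete] produces a
    floating arc, hence 0. Using [dcat] without the composability test gives a linear left inverse
    of [ins]. *)
Definition del_fun (y : Aminus k) : Aminus k := lext (fun d => basis k (dcat d (ddelete le_an))) y.
Lemma del_subproof y : del_fun y \in Pn_pred n.
Proof.
rewrite unfold_in; elim/Aminus_ind: y => [|d|c x y /eqP Hx /eqP Hy].
- by rewrite /del_fun linear0 mul0A.
- by rewrite /del_fun lext_basis basis_id eqxx.
- by rewrite /del_fun lextP mulA_linl Hx Hy.
Qed.
Definition del y : Pn k n := MkPn (del_subproof y).

Lemma del_ins (x : Pn k n) : del_fun (Pn_val (ins x)) = Pn_val x.
Proof.
rewrite ins_val -(eqP (Pn_valP x)); elim/Aminus_ind: (Pn_val x) => [|d|c u v Hu Hv].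
- by rewrite mul0A /del_fun !linear0.
- rewrite basis_id; case: (dright d =P n) => E; last by rewrite /del_fun !linear0.
  by rewrite lext_basis /dmul composable_insert // /del_fun lext_basis dcat_insert_delete.
- by rewrite mulA_linl lextP /del_fun lextP -!/(del_fun _) Hu Hv.
Qed.

Lemma ins_Sna x : x \in Sna n a -> ins x \in Sna n.+1 a.
Proof.
move=> /Sna_predP Hx; apply/Sna_predP; rewrite ins_val.
apply: supp_on_lext Hx _ => d /sarc_belowP[j lt s].
rewrite /dmul; case: ifP => C; last exact: supp_on0.
by apply/supp_on_basis/sarc_belowP; exists j => //; exact: right_sarc_insert.
Qed.

Lemma ins_Sna_inv x : ins x \in Sna n.+1 a -> x \in Sna n a.
Proof.
move=> /Sna_predP Hx; apply/Sna_predP; rewrite -del_ins.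
apply: supp_on_lext Hx _ => d /sarc_belowP[j lt s].
by apply/supp_on_basis/sarc_belowP; exists j => //; exact: right_sarc_delete.
Qed.

Lemma ins_SnaS x : ins x \in Sna n.+1 a.+1.
Proof.
apply/Sna_predP; rewrite ins_val.
apply: supp_on_lext (@Pn_supp _ x) _ => d _; rewrite /dmul; case: ifP => C; last exact: supp_on0.
by apply/supp_on_basis/sarc_belowP; exists a => //; exact: right_sarc_inserted.
Qed.

Lemma Sna_S m b x : x \in Sna m b -> ahom_id (Pn k m : amodType k) x \in Sna m b.+1.
Proof.
move=> /Sna_predP Hx; apply/Sna_predP => d /Hx/sarc_belowP[j lt s].
by apply/sarc_belowP; exists j => //; exact: ltnW.
Qed.

(** Checked on one diagram at a time: deleting and reinserting restores a diagram with a sarc at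
    [a], and keeps any sarc below [a]. So the difference is 0 in the former case, and both terms
    have a sarc below [a] in the latter. *)
Lemma Sna_split y : y \in Sna n.+1 a.+1 -> exists x, y - ins x \in Sna n.+1 a.
Proof.
move=> /Sna_predP Hy; exists (del (Pn_val y)); apply/Sna_predP.
pose g d := basis k d - lext (fun d => dmul k d (dinsert le_an)) (basis k (dcat d (ddelete le_an))).
have -> : Pn_val (y - ins (del (Pn_val y))) = lext g (Pn_val y).
  have -> : y - ins (del (Pn_val y)) = -1 *: ins (del (Pn_val y)) + y by rewrite scaleN1r addrC.
  rewrite Pn_valL ins_val; elim/Aminus_ind: (Pn_val y) => [|d|c u v Hu Hv].
  - by rewrite /= /del_fun !linear0 addr0.
  - by rewrite /= /del_fun lext_basis [RHS]lext_basis /g scaleN1r addrC.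
  - rewrite lextP -Hu -Hv /= /del_fun !lextP -!/(del_fun _) !scalerDr.
    by rewrite addrACA !scalerA mulrC.
apply: (@supp_on_lext _ (predI (fun d => dright d == n.+1) (sarc_below a.+1))).
  by move=> d nz; rewrite /= (Pn_supp nz) (Hy _ nz).
move=> d /= /andP[/eqP E /sarc_belowP[j lt s]]; rewrite /g lext_basis /dmul composable_insert //.
move: lt; rewrite ltnS leq_eqVlt => /orP[/eqP ej|lt].
  by rewrite dcat_delete_insert // -?ej // subrr; exact: supp_on0.
apply: supp_onB; apply/supp_on_basis/sarc_belowP; exists j => //.
by apply: right_sarc_insert => //; exact: right_sarc_delete.
Qed.

Lemma ses_Nna : exists (i : ahom (Nna n a) (Nna n.+1 a)) (p : ahom (Nna n.+1 a) (Nna n.+1 a.+1)),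
  ses i p.
Proof.
exists (qmap ins_Sna), (qmap (@Sna_S n.+1 a)).
by apply: ses_aquot; [exact: ins_Sna_inv|exact: ins_SnaS|exact: Sna_split].
Qed.
End Step.

(** For $a=0$ nothing is divided out of $P_n$. The step is
    $(x-1)^ax^{n+1-a}-(x-1)^ax^{n-a}=(x-1)^{a+1}x^{n-a}$. *)
Lemma euler_Nna a n : (a <= n)%N -> euler a.+1 (Nna n a) (('X - 1) ^+ a * 'X^(n - a)).
Proof.
elim: a n => [|a IH] n le.
  rewrite expr0 mul1r subn0 -(rk_Pn k n); apply: euler_iso (euler_fgproj (Pfg k n)).
  apply: aquot_trivial => x /Sna_predP H; apply: val_inj; apply/malgP => d.
  rewrite mcoeff0; apply/eqP; apply: contraT => /H/sarc_belowP[j].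
  by rewrite ltn0.
case: n le => // n le; have [i [p S]] := @ses_Nna a n le.
have := euler_cone S (IH n le) (IH n.+1 (leqW le)).
rewrite subSS subSn // exprS -mulrBr.
suff -> : 'X * 'X^(n - a) - 'X^(n - a) = ('X - 1) * 'X^(n - a) :> {poly int}.
  by rewrite mulrA -exprSr.
by rewrite mulrBl mul1r.
Qed.

Lemma euler_Mn n : euler n.+1 (Mn k n) (('X - 1) ^+ n).
Proof.
have := euler_Nna (leqnn n); rewrite subnn expr0 mulr1; apply: euler_iso.
(* All right sarcs of a diagram in $P_n$ lie among the first $n$ points. *)
apply: aquot_eq => x; apply/Sna_predP/Sn_predP => H d nz.
  by have /sarc_belowP[j _ s] := H d nz; exists j.
have [j s] := H d nz; apply/sarc_belowP; exists j => //.
by have /eqP <- := Pn_supp nz; case/andP: s.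
Qed.
End Filtered.

Theorem mainTheorem2 (k : fieldType) :
  inhabited (tensor_product k) /\
  forall T : tensor_product k,
  exists (one : K0 k) (mul : K0 k -> K0 k -> K0 k),
    [/\ is_ring K0_zero (@K0_opp k) (@K0_add k) one mul,
        (forall P Q : fgproj k, mul (K0_cls P) (K0_cls Q) = K0_cls (T P Q)) &
        exists phi : K0 k -> {poly int},
          [/\ [/\ bijective phi,
                  {morph phi : x y / K0_add x y >-> x + y},
                  {morph phi : x y / mul x y >-> x * y} &
                  phi one = 1],
              (forall n : nat, phi (K0_cls (Pfg k n)) = 'X^n),
              (forall psi : K0 k -> {poly int},
                 {morph psi : x y / K0_add x y >-> x + y} ->
                 (forall n : nat, psi (K0_cls (Pfg k n)) = 'X^n) ->
                 psi =1 phi) &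
              (forall n : nat,
                 inhabited (resolution (Mn k n)) /\
                 forall R : resolution (Mn k n),
                   phi (res_class R) = ('X - 1) ^+ n)]].
Proof.
split; first by constructor; exact: tensor_product_ex.
move=> T; have [g gK Kg] := K0_rk_bij k.
(* Multiplication is carried over from $\mathbb{Z}[x]$; compatibility with [T] is then exactly
   [rk_tens]. *)
pose mul (x y : K0 k) := g (K0_rk x * K0_rk y).
have rkM : {morph @K0_rk k : x y / mul x y >-> x * y} by move=> x y; rewrite /mul Kg.
have inj := can_inj gK.
exists (g 1), mul; split.
- split; [exact: K0_addA|exact: K0_addC|exact: K0_add0|exact: K0_addN|..].
  + by move=> x y z; apply: inj; rewrite !rkM mulrA.
  + by move=> x; apply: inj; rewrite rkM Kg mul1r.
  + by move=> x; apply: inj; rewrite rkM Kg mulr1.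
  + by move=> x y z; apply: inj; rewrite rkM !K0_rkD !rkM mulrDl.
  + by move=> x y z; apply: inj; rewrite rkM !K0_rkD !rkM mulrDr.
- by move=> P Q; apply: inj; rewrite rkM !K0_rk_cls rk_tens.
exists (@K0_rk k); split.
- split; [exact: K0_rk_bij|exact: K0_rkD|exact: rkM|exact: Kg].
- by move=> n; rewrite K0_rk_cls rk_Pn.
- by move=> psi D X; exact: K0_rk_uniq.
move=> n; split; first exact: euler_resolution (euler_Mn k n).
move=> R; exact: euler_uniq (resolution_euler R) (euler_Mn k n).
Qed.
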